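(* Let $S$ be the curve $y(y+x^2)(y-x^2)=0$. Its local braid monodromy $\beta$ at $(0,0)$ is: the three points $y=-1,0,1$ of the fiber over $x=1$ do two counterclockwise generalized full-twists, i.e. $\beta$ is the braid induced by rotating the set $\{-1,0,1\}$ about $0$ by the angle $4\pi$ counterclockwise. The induced relations are $$(x_3x_2x_1)^2=(x_1x_3x_2)^2=(x_2x_1x_3)^2,$$ where $\{x_1,x_2,x_3\}$ are the generators of the standard g-base.
   Context: Let $E=\{x\in\mathbb{C}:|x|\le 1\}$, $D=\{y\in\mathbb{C}:|y|\le 4\}$, and regard $S$ as a curve in $E\times D$. The projection of $S$ to $E$ has fibers of constant cardinality $n$ ($n=3$ here) except over $x=0$. Let $K\subset D$ be the set of $y$-coordinates of the points of $S$ over $x=1$. A motion of $K$ in $D$ consists of $n$ continuous functions $m_i:[0,1]\to D$ with $m_i(t)\ne m_j(t)$ for all $t$ and $i\neq j$, and $\{m_i(0)\}=\{m_i(1)\}=K$. It is realized by a continuous family of diffeomorphisms $D_t$ of $D$, $D_0=\mathrm{Id}$, equal to the identity on $\partial D$, with $D_t(m_i(0))=m_i(t)$; the braid induced by the motion is the class of $D_1$ in the braid group $B_n[D,K]$, the group of diffeomorphisms of $D$ preserving $K$ and equal to the identity on $\partial D$, two being identified if they induce the same automorphism of $\pi_1(D-K,u_0)$. The local braid monodromy $\beta$ of $S$ at $(0,0)$ is the braid induced by the motion formed by the points of $S$ over $x=e^{2\pi i t}$, $0\le t\le 1$. Standard g-base: take the base point $u_0=-4i$ and let $p_1<\dots<p_n$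 be the (real) points of $K$. The loop $x_i$ goes from $u_0$ along the straight segment to near $p_i$, once counterclockwise around $p_i$ on a small circle, and back. In a product of loops the left factor is traversed first. The group $\pi_1(D-K,u_0)$ is free on $x_1,\dots,x_n$. The relations induced by $\beta$ are $\beta(x_j)=x_j$, $j=1,\dots,n$. Saying that ''the induced relations are $R$'' means that $R$ and $\{\beta(x_j)=x_j\}_j$ have the same normal closure in the free group on $x_1,\dots,x_n$. *)

(* Defs.v *)
From HB Require Import structures.
From mathcomp Require Import all_boot all_order all_algebra generic_quotient.
From mathcomp Require Import complex ring lra.
From mathcomp Require Import all_classical all_reals all_analysis.

Set Implicit Arguments.
Unset Strict Implicit.
Unset Printing Implicit Defensive.

Import Order.TTheory GRing.Theory Num.Theory numFieldNormedType.Exports.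

Local Open Scope classical_set_scope.
Local Open Scope ring_scope.
Local Open Scope complex_scope.
Local Open Scope quotient_scope.

(* The topology of the norm on R[i]; without this it is only found on R[i]^o. *)
HB.instance Definition _ (R : realType) := NormedModule.copy R[i] R[i]^o.

Notation unit_interval R := (`[0, 1]%classic : set R).

Section ComplexPlane.
Variable R : realType.
Local Notation C := R[i].
Local Notation I := (unit_interval R).

Definition expi (t : R) : C := cos t +i* sin t.

End ComplexPlane.

Section Continuity.
Variable R : realType.
Local Notation C := R[i].
Local Notation I := (unit_interval R).

Lemma within_comp (T U V : topologicalType) (A : set T) (B : set U)
    (f : T -> V) (phi : U -> T) :
  {within A, continuous f} -> {within B, continuous phi} ->
  (forall x, B x -> A (phi x)) -> {within B, continuous (f \o phi)}.
Proof.
move=> /subspace_continuousP cf /subspace_continuousP cphi BA.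
apply/subspace_continuousP => x Bx W /= Wfx.
have := cf _ (BA _ Bx) W Wfx; rewrite !nbhs_filterE /fmap /= /within /= => h.
have := cphi _ Bx _ h; rewrite /fmap /= /within /nbhs /=.
by apply: filterS => y hy By; apply: hy => //; exact: BA.
Qed.

Lemma within_eq (T V : topologicalType) (A : set T) (f g : T -> V) :
  (forall x, A x -> f x = g x) ->
  {within A, continuous f} -> {within A, continuous g}.
Proof.
move=> fg; apply: subspace_eq_continuous => x.
by rewrite inE => /fg.
Qed.

Lemma within_sub (T V : topologicalType) (A B : set T) (f : T -> V) :
  B `<=` A -> {within A, continuous f} -> {within B, continuous f}.
Proof. by move=> BA; exact: continuous_subspaceW. Qed.

Lemma within_cts (T V : topologicalType) (A : set T) (f : T -> V) :
  continuous f -> {within A, continuous f}.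
Proof. by move=> cf; exact: continuous_subspaceT. Qed.

Lemma within_pair (T U V : topologicalType) (A : set T) (f : T -> U)
    (g : T -> V) :
  {within A, continuous f} -> {within A, continuous g} ->
  {within A, continuous (fun x => (f x, g x))}.
Proof. by move=> cf cg x; exact: (cvg_pair (cf x) (cg x)). Qed.

Lemma cvg_complex (T : Type) (F : set_system T) (f : T -> C) (z : C) :
  Filter F ->
  (complex.Re (f x) @[x --> F] --> complex.Re z) ->
  (complex.Im (f x) @[x --> F] --> complex.Im z) ->
  (f x @[x --> F] --> z).
Proof.
move=> FF /cvgrPdist_lt hre /cvgrPdist_lt him; apply/cvgrPdist_lt => e e0.
have er : 0 < complex.Re e by case: e e0 => a b; rewrite ltcE /= => /andP[].
have ei : complex.Im e = 0.
  by case: e e0 {er} => a b; rewrite ltcE /= => /andP[/eqP].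
have e2 : 0 < complex.Re e / 2 by rewrite divr_gt0.
near=> x.
have h1 : `|complex.Re z - complex.Re (f x)| < complex.Re e / 2.
  by near: x; exact: hre.
have h2 : `|complex.Im z - complex.Im (f x)| < complex.Re e / 2.
  by near: x; exact: him.
have -> : e = (complex.Re e)%:C by case: (e) ei => a b /= ->.
have -> : z - f x = (complex.Re z - complex.Re (f x))%:C +
    'i%C * (complex.Im z - complex.Im (f x))%:C.
  rewrite [LHS]complexE; congr (_%:C + _ * _%:C).
    by case: (z) (f x) => ? ? [].
  by case: (z) (f x) => ? ? [].
apply: (le_lt_trans (ler_normD _ _)).
have -> : complex.Re e = complex.Re e / 2 + complex.Re e / 2.
  by rewrite -splitr.
rewrite normrM.
have -> : `|'i%C| = 1 :> C.
  by rewrite normc_def /= expr0n expr1n add0r sqrtr1.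
rewrite mul1r !normc_def /= expr0n addr0 addr0 !sqrtr_sqr -rmorphD /=.
by rewrite ltcR; exact: ltrD.
Unshelve. all: by end_near.
Qed.

Definition clamp (t : R) : R := Num.max 0 (Num.min 1 t).

Lemma clampI t : I (clamp t).
Proof.
rewrite /clamp /= in_itv /= le_max lexx /= ge_max ler01 /=.
by rewrite ge_min lexx.
Qed.

Lemma clamp_id t : I t -> clamp t = t.
Proof.
rewrite /clamp /= in_itv /= => /andP[t0 t1].
by rewrite min_r // max_r.
Qed.

Lemma clamp_le0 t : t <= 0 -> clamp t = 0.
Proof. by move=> t0; rewrite /clamp max_l // ge_min t0 orbT. Qed.

Lemma clamp_ge1 t : 1 <= t -> clamp t = 1.
Proof. by move=> t1; rewrite /clamp min_l // max_r. Qed.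

Lemma continuous_clamp : continuous clamp.
Proof.
have c0 : continuous (fun _ : R => 0 : R) by move=> t; exact: cvg_cst.
have c1 : continuous (fun _ : R => 1 : R) by move=> t; exact: cvg_cst.
have cid : continuous (fun t : R => t) by move=> t; exact: cvg_id.
exact: (max_fun_continuous c0 (min_fun_continuous c1 cid)).
Qed.

Lemma continuous_affine (a b : R) : continuous (fun t : R => a * t + b).
Proof.
move=> t; apply: cvgD; last exact: cvg_cst.
by apply: cvgM; [exact: cvg_cst|exact: cvg_id].
Qed.

Lemma continuous_clamp_affine (a b : R) :
  continuous (fun t : R => clamp (a * t + b)).
Proof.
move=> t; apply: (@continuous_comp _ _ _ (fun t : R => a * t + b) clamp).
  exact: continuous_affine.
exact: continuous_clamp.
Qed.

End Continuity.

Section Homotopy.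
Variable R : realType.
Local Notation C := R[i].
Local Notation I := (unit_interval R).
Variable X : set C.

(* Homotopy in X relative to the end points, for maps defined on [0, 1] (the
   values of f and g off [0, 1] play no role). *)
Definition path_homotopic (f g : R -> C) : Prop :=
  exists H : R * R -> C,
    [/\ {within I `*` I, continuous H},
        forall p, (I `*` I) p -> X (H p),
        forall t, I t -> H (0, t) = f t /\ H (1, t) = g t &
        forall s, I s -> H (s, 0) = f 0 /\ H (s, 1) = f 1].

Lemma I0 : I 0. Proof. by rewrite /= in_itv /= lexx ler01. Qed.
Lemma I1 : I 1. Proof. by rewrite /= in_itv /= lexx ler01. Qed.

Lemma path_homotopic_reparam (f : R -> C) (phi psi : R -> R) :
  {within I, continuous f} -> (forall t, I t -> X (f t)) ->
  continuous phi -> continuous psi ->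
  (forall t, I t -> I (phi t)) -> (forall t, I t -> I (psi t)) ->
  phi 0 = psi 0 -> phi 1 = psi 1 ->
  path_homotopic (f \o phi) (f \o psi).
Proof.
move=> cf fX cphi cpsi phiI psiI e0 e1.
pose h (p : R * R) : R := (1 - p.1) * phi p.2 + p.1 * psi p.2.
have hI p : (I `*` I) p -> I (h p).
  move=> [/= + p2]; have := phiI _ p2; have := psiI _ p2.
  rewrite /h /= !in_itv /= => /andP[a1 a2] /andP[b1 b2] /andP[c1 c2].
  by apply/andP; split; nra.
have ch : continuous h.
  move=> p; apply: cvgD; apply: cvgM.
  - by apply: cvgB; [exact: cvg_cst|exact: cvg_fst].
  - by apply: (@continuous_comp _ _ _ snd phi); [exact: cvg_snd|exact: cphi].
  - exact: cvg_fst.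
  - by apply: (@continuous_comp _ _ _ snd psi); [exact: cvg_snd|exact: cpsi].
exists (f \o h); split.
- apply: (within_comp cf (within_cts ch)) => p; exact: hI.
- by move=> p /hI/fX.
- by move=> t It; rewrite /h /=; split; congr f; ring.
- by move=> s Is; rewrite /h /= -e0 -e1; split; congr f; ring.
Qed.

Lemma path_homotopic_eq (f g f' g' : R -> C) :
  (forall t, I t -> f t = f' t) -> (forall t, I t -> g t = g' t) ->
  path_homotopic f g -> path_homotopic f' g'.
Proof.
move=> ff' gg' [H [cH HX H01 H0]]; exists H; split=> //.
- by move=> t It; rewrite -ff' // -gg' //; exact: H01.
- by move=> s Is; rewrite -!ff' //; [exact: H0|exact: I1|exact: I0].
Qed.

Lemma path_homotopic_refl (f : R -> C) :
  {within I, continuous f} -> (forall t, I t -> X (f t)) ->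
  path_homotopic f f.
Proof.
move=> cf fX; have cid : continuous (fun t : R => t).
  by move=> t; exact: cvg_id.
exact: (@path_homotopic_reparam f _ _ cf fX cid cid).
Qed.

Lemma path_homotopic_sym (f g : R -> C) :
  path_homotopic f g -> path_homotopic g f.
Proof.
move=> [H [cH HX H01 H0]].
have rI (s : R) : I s -> I (1 - s).
  by rewrite /= !in_itv /= => /andP[? ?]; apply/andP; split; lra.
exists (H \o (fun p : R * R => (1 - p.1, p.2))); split.
- apply: (within_comp cH).
    apply: within_pair; apply: within_cts => p; last exact: cvg_snd.
    by apply: cvgB; [exact: cvg_cst|exact: cvg_fst].
  by move=> [s t] [/= Is It]; split=> //=; exact: rI.
- by move=> [s t] [/= Is It]; apply: HX; split=> //=; exact: rI.
- move=> t It /=; rewrite subr0 subrr.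
  by have [-> ->] := H01 _ It.
- move=> s Is /=; have [-> ->] := H0 _ (rI _ Is).
  have [_ <-] := H01 _ I0; have [_ <-] := H01 _ I1.
  by have [-> ->] := H0 _ I1.
Qed.

Lemma path_homotopic_trans (f g h : R -> C) :
  path_homotopic f g -> path_homotopic g h -> path_homotopic f h.
Proof.
move=> [H [cH HX H01 H0]] [K [cK KX K01 K0]].
pose phi (a b : R) (p : R * R) := (clamp (a * p.1 + b), p.2).
have cphi a b : {within I `*` I, continuous (phi a b)}.
  apply: within_pair; apply: within_cts => p; last exact: cvg_snd.
  apply: (@continuous_comp _ _ _ fst (fun t => clamp (a * t + b))).
    exact: cvg_fst.
  exact: continuous_clamp_affine.
have phiI a b p : (I `*` I) p -> (I `*` I) (phi a b p).
  by move=> [_ p2]; split=> //=; exact: clampI.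
pose g' (p : R * R) := H (1, p.2).
have cg' : {within I `*` I, continuous g'}.
  have c1 : {within I `*` I, continuous (fun p : R * R => (1 : R, p.2))}.
    apply: within_pair; apply: within_cts => p; first exact: cvg_cst.
    exact: cvg_snd.
  apply: (within_comp cH c1) => p [_ p2].
  by split=> //=; exact: I1.
pose L p := H (phi 2 0 p) + K (phi 2 (- 1) p) - g' p.
have LE p : (I `*` I) p -> L p =
    if p.1 <= 2^-1 then H (2 * p.1, p.2) else K (2 * p.1 - 1, p.2).
  case: p => s t [/= Is It]; rewrite /L /phi /g' /=.
  move: Is; rewrite in_itv /= => /andP[s0 s1].
  case: ifPn => [s2|]; last rewrite -ltNge => s2.
    rewrite (@clamp_le0 _ (_ - 1)); last by lra.
    rewrite clamp_id; last by rewrite /= in_itv /=; apply/andP; split; lra.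
    have [-> _] := K01 _ It; have [_ ->] := H01 _ It.
    by rewrite addr0 addrK.
  rewrite (@clamp_ge1 _ (_ + 0)); last by lra.
  rewrite clamp_id; last by rewrite /= in_itv /=; apply/andP; split; lra.
  by rewrite addrAC subrr add0r.
exists L; split.
- have cHp := within_comp cH (cphi 2 0) (phiI 2 0).
  have cKp := within_comp cK (cphi 2 (- 1)) (phiI 2 (- 1)).
  by move=> x; exact: (cvgB (cvgD (cHp x) (cKp x)) (cg' x)).
- move=> p Ip; rewrite LE //; case: p Ip => s t [/= Is It].
  move: Is; rewrite in_itv /= => /andP[s0 s1].
  case: ifPn => [s2|]; last rewrite -ltNge => s2.
    by apply: HX; split=> //=; rewrite in_itv /=; apply/andP; split; lra.
  by apply: KX; split=> //=; rewrite in_itv /=; apply/andP; split; lra.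
- move=> t It; rewrite !LE //=; try by split=> //=; (exact: I0 || exact: I1).
  rewrite mulr0 mulr1 invr_ge0 ler0n.
  rewrite ifF; last by apply/negbTE; rewrite -ltNge; lra.
  have -> : 2 - 1 = 1 :> R by ring.
  by split; [have [] := H01 _ It|have [] := K01 _ It].
- move=> s Is; rewrite !LE //=; try by split=> //=; (exact: I0 || exact: I1).
  have [_ e0] := H01 _ I0; have [_ e1] := H01 _ I1.
  have [e2 e3] := H0 _ I1.
  move: Is; rewrite /= in_itv /= => /andP[s0 s1].
  case: ifPn => [s2|]; last rewrite -ltNge => s2.
    by apply: H0; rewrite /= in_itv /=; apply/andP; split; lra.
  rewrite -e2 -e3 e0 e1.
  by apply: K0; rewrite /= in_itv /=; apply/andP; split; lra.
Qed.

End Homotopy.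

Section Concatenation.
Variable R : realType.
Local Notation C := R[i].
Local Notation I := (unit_interval R).

Definition path_cat (f g : R -> C) (t : R) : C :=
  if t <= 2^-1 then f (2 * t) else g (2 * t - 1).

Definition path_rev (f : R -> C) (t : R) : C := f (1 - t).

Lemma path_cat0 f g : path_cat f g 0 = f 0.
Proof. by rewrite /path_cat invr_ge0 ler0n mulr0. Qed.

Lemma path_cat1 f g : path_cat f g 1 = g 1.
Proof.
rewrite /path_cat ifF; last by apply/negbTE; rewrite -ltNge; lra.
by congr g; ring.
Qed.

Lemma path_catE f g t : f 1 = g 0 -> I t ->
  path_cat f g t = f (clamp (2 * t + 0)) + g (clamp (2 * t + - 1)) - g 0.
Proof.
move=> fg; rewrite /= in_itv /= => /andP[t0 t1]; rewrite /path_cat.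
case: ifPn => [t2|]; last rewrite -ltNge => t2.
  rewrite (@clamp_le0 _ (_ - 1)); last by lra.
  rewrite clamp_id; last by rewrite /= in_itv /=; apply/andP; split; lra.
  by rewrite addr0 addrK.
rewrite (@clamp_ge1 _ (_ + 0)); last by lra.
rewrite clamp_id; last by rewrite /= in_itv /=; apply/andP; split; lra.
by rewrite fg addrAC subrr add0r.
Qed.

Lemma path_cat_cts f g : f 1 = g 0 ->
  {within I, continuous f} -> {within I, continuous g} ->
  {within I, continuous (path_cat f g)}.
Proof.
move=> fg cf cg; apply: within_eq => [t It|]; first exact/esym/path_catE.
have cp a b : {within I, continuous (fun t : R => clamp (a * t + b))}.
  exact: within_cts (@continuous_clamp_affine _ a b).
have pI a b t : I t -> I (clamp (a * t + b)) by move=> _; exact: clampI.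
have cfp := within_comp cf (cp 2 0) (pI 2 0).
have cgp := within_comp cg (cp 2 (- 1)) (pI 2 (- 1)).
by move=> x; exact: (cvgB (cvgD (cfp x) (cgp x)) (cvg_cst _)).
Qed.

Lemma path_cat_in (X : set C) f g :
  (forall t, I t -> X (f t)) -> (forall t, I t -> X (g t)) ->
  forall t, I t -> X (path_cat f g t).
Proof.
move=> fX gX t; rewrite /= in_itv /= => /andP[t0 t1]; rewrite /path_cat.
case: ifPn => [t2|]; last rewrite -ltNge => t2.
  by apply: fX; rewrite /= in_itv /=; apply/andP; split; lra.
by apply: gX; rewrite /= in_itv /=; apply/andP; split; lra.
Qed.

Lemma rev_itv (t : R) : I t -> I (1 - t).
Proof. by rewrite /= !in_itv /= => /andP[? ?]; apply/andP; split; lra. Qed.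

Lemma path_rev_cts f :
  {within I, continuous f} -> {within I, continuous (path_rev f)}.
Proof.
move=> cf; have c1 : {within I, continuous (fun t : R => 1 - t)}.
  by apply: within_cts => t; apply: cvgB; [exact: cvg_cst|exact: cvg_id].
exact: (within_comp cf c1 rev_itv).
Qed.

Variable X : set C.

Lemma path_homotopic_cat (f g f' g' : R -> C) : f 1 = g 0 ->
  path_homotopic X f f' -> path_homotopic X g g' ->
  path_homotopic X (path_cat f g) (path_cat f' g').
Proof.
move=> fg [H [cH HX H01 H0]] [K [cK KX K01 K0]].
have [_ f'0] := H0 _ (@I1 R); have [_ f'1] := H01 _ (@I1 R).
have [g'0 _] := K0 _ (@I1 R); have [_ g'1] := K01 _ (@I0 R).
have f1 : f' 1 = f 1 by rewrite -f'0 -f'1.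
have g0 : g' 0 = g 0 by rewrite -g'0 -g'1.
pose phi (a b : R) (p : R * R) := (p.1, clamp (a * p.2 + b)).
have cphi a b : {within I `*` I, continuous (phi a b)}.
  apply: within_pair; apply: within_cts => p; first exact: cvg_fst.
  apply: (@continuous_comp _ _ _ snd (fun t => clamp (a * t + b))).
    exact: cvg_snd.
  exact: continuous_clamp_affine.
have phiI a b p : (I `*` I) p -> (I `*` I) (phi a b p).
  by move=> [p1 _]; split=> //=; exact: clampI.
pose L p := H (phi 2 0 p) + K (phi 2 (- 1) p) - g 0.
have LE s t : I s -> I t -> L (s, t) =
    path_cat (fun t => H (s, t)) (fun t => K (s, t)) t.
  move=> Is It; have [hs0 hs1] := H0 _ Is; have [ks0 ks1] := K0 _ Is.
  by rewrite path_catE //= ?ks0 // hs1.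
exists L; split.
- have cHp := within_comp cH (cphi 2 0) (phiI 2 0).
  have cKp := within_comp cK (cphi 2 (- 1)) (phiI 2 (- 1)).
  by move=> x; exact: (cvgB (cvgD (cHp x) (cKp x)) (cvg_cst _)).
- move=> [s t] [/= Is It]; rewrite LE //; apply: path_cat_in It => t' It'.
    exact: HX.
  exact: KX.
- move=> t It; rewrite !LE; try exact: It; try exact: I0; try exact: I1.
  move: It; rewrite /path_cat /= in_itv /= => /andP[t0 t1].
  case: ifPn => [t2|]; last rewrite -ltNge => t2.
    by apply: H01; rewrite /= in_itv /=; apply/andP; split; lra.
  by apply: K01; rewrite /= in_itv /=; apply/andP; split; lra.
- move=> s Is; rewrite !LE; try exact: Is; try exact: I0; try exact: I1.
  rewrite !path_cat0 !path_cat1.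
  by have [-> _] := H0 _ Is; have [_ ->] := K0 _ Is.
Qed.

Lemma path_homotopic_rev (f g : R -> C) :
  path_homotopic X f g -> path_homotopic X (path_rev f) (path_rev g).
Proof.
move=> [H [cH HX H01 H0]].
have c1 : {within I `*` I, continuous (fun p : R * R => (p.1, 1 - p.2))}.
  apply: within_pair; apply: within_cts => p; first exact: cvg_fst.
  by apply: cvgB; [exact: cvg_cst|exact: cvg_snd].
have I1' p : (I `*` I) p -> (I `*` I) (p.1, 1 - p.2).
  by move=> [p1 p2]; split=> //=; exact: rev_itv.
exists (H \o (fun p : R * R => (p.1, 1 - p.2))); split.
- exact: (within_comp cH c1 I1').
- by move=> p /I1'/HX.
- by move=> t /rev_itv It; exact: H01.
- move=> s Is /=; rewrite /path_rev subr0 subrr.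
  by have [-> ->] := H0 _ Is.
Qed.

End Concatenation.

Section FundamentalGroup.
Variable R : realType.
Local Notation C := R[i].
Local Notation I := (unit_interval R).
Variables (X : set C) (u : X).

Record loop := Loop {
  loop_fun :> R -> C;
  loop_cts : {within I, continuous loop_fun};
  loop_in : forall t, I t -> X (loop_fun t);
  loop0 : loop_fun 0 = set_val u;
  loop1 : loop_fun 1 = set_val u }.

HB.instance Definition _ := gen_eqMixin loop.
HB.instance Definition _ := gen_choiceMixin loop.

Definition loop_equiv (f g : loop) : bool := `[< path_homotopic X f g >].

Lemma loop_equiv_refl : reflexive loop_equiv.
Proof.
by move=> f; apply/asboolP; apply: (path_homotopic_refl (@loop_cts f)); exact: loop_in.
Qed.

Lemma loop_equiv_sym : symmetric loop_equiv.
Proof. by move=> f g; apply/asboolP/asboolP => /path_homotopic_sym. Qed.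

Lemma loop_equiv_trans : transitive loop_equiv.
Proof.
move=> g f h /asboolP fg /asboolP gh; apply/asboolP.
exact: path_homotopic_trans fg gh.
Qed.

Canonical loop_equiv_equiv :=
  EquivRel loop_equiv loop_equiv_refl loop_equiv_sym loop_equiv_trans.

Definition pi1 : Type := {eq_quot loop_equiv}.
HB.instance Definition _ := Choice.on pi1.
HB.instance Definition _ := EqQuotient.on pi1.

Lemma loop_classP (f g : loop) :
  reflect (path_homotopic X f g) (\pi_pi1 f == \pi_pi1 g).
Proof. by apply: (iffP idP) => [|]; rewrite eqmodE => /asboolP. Qed.

Lemma loop_cst_cts : {within I, continuous (fun=> set_val u)}.
Proof. by apply: within_cts => t; exact: cvg_cst. Qed.

Lemma loop_cst_in t : I t -> X (set_val u).
Proof. by move=> _; apply: set_mem; exact: (valP u). Qed.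

Definition loop_cst : loop :=
  @Loop (fun=> set_val u) loop_cst_cts loop_cst_in erefl erefl.

Lemma loop_cat_cts (f g : loop) : {within I, continuous (path_cat f g)}.
Proof.
by apply: path_cat_cts; [rewrite loop0 loop1|exact: loop_cts|exact: loop_cts].
Qed.

Lemma loop_cat_in (f g : loop) t : I t -> X (path_cat f g t).
Proof. by move=> It; apply: path_cat_in It; exact: loop_in. Qed.

Lemma loop_cat0 (f g : loop) : path_cat f g 0 = set_val u.
Proof. by rewrite path_cat0 loop0. Qed.

Lemma loop_cat1 (f g : loop) : path_cat f g 1 = set_val u.
Proof. by rewrite path_cat1 loop1. Qed.

Definition loop_cat (f g : loop) : loop :=
  Loop (@loop_cat_cts f g) (@loop_cat_in f g) (loop_cat0 f g) (loop_cat1 f g).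

Lemma loop_rev_in (f : loop) t : I t -> X (path_rev f t).
Proof. by move=> It; apply: loop_in; exact: rev_itv. Qed.

Lemma loop_rev0 (f : loop) : path_rev f 0 = set_val u.
Proof. by rewrite /path_rev subr0 loop1. Qed.

Lemma loop_rev1 (f : loop) : path_rev f 1 = set_val u.
Proof. by rewrite /path_rev subrr loop0. Qed.

Definition loop_rev (f : loop) : loop :=
  Loop (path_rev_cts (@loop_cts f)) (@loop_rev_in f) (loop_rev0 f) (loop_rev1 f).

Definition pi1_one : pi1 := \pi_pi1 loop_cst.
Definition pi1_mul (x y : pi1) : pi1 := \pi_pi1 (loop_cat (repr x) (repr y)).
Definition pi1_inv (x : pi1) : pi1 := \pi_pi1 (loop_rev (repr x)).

Lemma repr_homotopic (f : loop) : path_homotopic X (repr (\pi_pi1 f)) f.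
Proof. by apply/loop_classP; rewrite reprK. Qed.

Lemma pi1_mulE (f g : loop) :
  pi1_mul (\pi_pi1 f) (\pi_pi1 g) = \pi_pi1 (loop_cat f g).
Proof.
apply/eqP/loop_classP; apply: path_homotopic_cat.
- by rewrite loop0 loop1.
- exact: repr_homotopic.
- exact: repr_homotopic.
Qed.

Lemma pi1_invE (f : loop) : pi1_inv (\pi_pi1 f) = \pi_pi1 (loop_rev f).
Proof.
by apply/eqP/loop_classP; apply: path_homotopic_rev; exact: repr_homotopic.
Qed.

Lemma loop_reparam (f g h : loop) (phi psi : R -> R) :
  continuous phi -> continuous psi ->
  (forall t, I t -> I (phi t)) -> (forall t, I t -> I (psi t)) ->
  phi 0 = psi 0 -> phi 1 = psi 1 ->
  (forall t, I t -> g t = f (phi t)) -> (forall t, I t -> h t = f (psi t)) ->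
  \pi_pi1 g = \pi_pi1 h.
Proof.
move=> cphi cpsi phiI psiI e0 e1 gE hE; apply/eqP/loop_classP.
have := path_homotopic_reparam (@loop_cts f) (@loop_in f) cphi cpsi phiI psiI
  e0 e1.
by apply: path_homotopic_eq => t It /=; rewrite ?gE ?hE.
Qed.

Lemma continuous_affine_max (a b c d : R) :
  continuous (fun t : R => Num.max (a * t + b) (c * t + d)).
Proof.
exact: (max_fun_continuous (@continuous_affine _ a b) (@continuous_affine _ c d)).
Qed.

Lemma continuous_affine_min (a b c d : R) :
  continuous (fun t : R => Num.min (a * t + b) (c * t + d)).
Proof.
exact: (min_fun_continuous (@continuous_affine _ a b) (@continuous_affine _ c d)).
Qed.

Lemma continuous_idR : continuous (fun t : R => t).
Proof. by move=> t; exact: cvg_id. Qed.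

Lemma pi1_mul1 : left_id pi1_one pi1_mul.
Proof.
elim/quotW => f; rewrite /pi1_one pi1_mulE.
apply: (@loop_reparam f _ _ (fun t => Num.max (0 * t + 0) (2 * t + - 1))
  (fun t => t)) => //.
- exact: continuous_affine_max.
- exact: continuous_idR.
- move=> t; rewrite /= !in_itv /= => /andP[t0 t1].
  by rewrite le_max ge_max; apply/andP; split; [apply/orP; left|apply/andP; split]; lra.
- by rewrite max_l; lra.
- by rewrite max_r; lra.
- move=> t It; rewrite /= /path_cat; case: ifPn => [t2|].
    by rewrite max_l ?loop0; [rewrite mul0r addr0 loop0|lra].
  by rewrite -ltNge => t2; rewrite max_r //; lra.
Qed.

Lemma pi1_mulr1 : right_id pi1_one pi1_mul.
Proof.
elim/quotW => f; rewrite /pi1_one pi1_mulE.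
apply: (@loop_reparam f _ _ (fun t => Num.min (2 * t + 0) (0 * t + 1))
  (fun t => t)) => //.
- exact: continuous_affine_min.
- exact: continuous_idR.
- move=> t; rewrite /= !in_itv /= => /andP[t0 t1].
  by rewrite ge_min le_min; apply/andP; split; [apply/andP; split|apply/orP; right]; lra.
- by rewrite min_l; lra.
- by rewrite min_r; lra.
- move=> t It; rewrite /= /path_cat; case: ifPn => [t2|].
    by rewrite min_l ?addr0 //; lra.
  by rewrite -ltNge => t2; rewrite min_r; [rewrite mul0r add0r loop1|lra].
Qed.

Lemma pi1_mulV : left_inverse pi1_one pi1_inv pi1_mul.
Proof.
elim/quotW => f; rewrite /pi1_one pi1_invE pi1_mulE.
apply: (@loop_reparam f _ _ (fun t => Num.max (- 2 * t + 1) (2 * t + - 1))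
  (fun t => 1)) => //.
- exact: continuous_affine_max.
- by move=> t; exact: cvg_cst.
- move=> t; rewrite /= !in_itv /= => /andP[t0 t1].
  rewrite le_max ge_max; apply/andP; split; last by apply/andP; split; lra.
  by apply/orP; case: (leP t 2^-1) => t2; [left|right]; lra.
- by move=> t _; exact: I1.
- by rewrite max_l; lra.
- by rewrite max_r; lra.
- move=> t It; rewrite /= /path_cat /path_rev; case: ifPn => [t2|].
    by rewrite max_l; [congr (f _); ring|lra].
  by rewrite -ltNge => t2; rewrite max_r //; lra.
- by move=> t It /=; rewrite loop1.
Qed.

Lemma pi1_mulrV : right_inverse pi1_one pi1_inv pi1_mul.
Proof.
elim/quotW => f; rewrite /pi1_one pi1_invE pi1_mulE.
apply: (@loop_reparam f _ _ (fun t => Num.min (2 * t + 0) (- 2 * t + 2))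
  (fun t => 0)) => //.
- exact: continuous_affine_min.
- by move=> t; exact: cvg_cst.
- move=> t; rewrite /= !in_itv /= => /andP[t0 t1].
  rewrite ge_min le_min; apply/andP; split; first by apply/andP; split; lra.
  by apply/orP; case: (leP t 2^-1) => t2; [left|right]; lra.
- by move=> t _; exact: I0.
- by rewrite min_l; lra.
- by rewrite min_r; lra.
- move=> t It; rewrite /= /path_cat /path_rev; case: ifPn => [t2|].
    by rewrite min_l; [congr (f _); ring|lra].
  by rewrite -ltNge => t2; rewrite min_r; [congr (f _); ring|lra].
- by move=> t It /=; rewrite loop0.
Qed.

Lemma pi1_mulA : associative pi1_mul.
Proof.
elim/quotW => f; elim/quotW => g; elim/quotW => h.
rewrite (pi1_mulE g h) (pi1_mulE f g) !pi1_mulE.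
pose phi (t : R) := Num.max (2^-1 * t + 0)
  (Num.max (1 * t + - 4^-1) (2 * t + - 1)).
apply: (@loop_reparam (loop_cat (loop_cat f g) h) _ _ phi (fun t => t)) => //.
- exact: (max_fun_continuous (@continuous_affine _ 2^-1 0)
    (continuous_affine_max (a := 1) (b := - 4^-1) (c := 2) (d := - 1))).
- exact: continuous_idR.
- move=> t; rewrite /phi /= !in_itv /= => /andP[t0 t1].
  rewrite le_max !ge_max; apply/andP; split; first by apply/orP; left; lra.
  by apply/andP; split; [lra|apply/andP; split; lra].
- by rewrite /phi max_l // ?ge_max; [lra|apply/andP; split; lra].
- by rewrite /phi max_r ?le_max; [rewrite max_r; lra|apply/orP; right; lra].
move=> t It; rewrite /phi /= /path_cat; case: ifPn => [t2|].
  rewrite max_l; last by rewrite ge_max; apply/andP; split; lra.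
  rewrite ifT; last by lra.
  rewrite ifT; last by lra.
  by congr (f _); field.
rewrite -ltNge => t2; case: ifPn => [t3|].
  rewrite max_r; last by rewrite le_max; apply/orP; left; lra.
  rewrite max_l; last by lra.
  rewrite ifT; last by lra.
  rewrite ifF; last by apply/negbTE; rewrite -ltNge; lra.
  by congr (g _); field.
rewrite -ltNge => t3.
rewrite max_r; last by rewrite le_max; apply/orP; right; lra.
rewrite max_r; last by lra.
rewrite ifF; last by apply/negbTE; rewrite -ltNge; lra.
by congr (h _); ring.
Qed.

HB.instance Definition _ := isGroup.Build pi1
  pi1_mulA pi1_mul1 pi1_mulr1 pi1_mulV pi1_mulrV.

Lemma pi1_catE (f g : loop) :
  (\pi_pi1 f * \pi_pi1 g)%g = \pi_pi1 (loop_cat f g).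
Proof. exact: pi1_mulE. Qed.

End FundamentalGroup.

Section NormalClosure.
Local Open Scope group_scope.
Variable G : groupType.

Definition normal_subgroup (N : set G) : Prop :=
  [/\ N 1, forall x y, N x -> N y -> N (x * y), forall x, N x -> N x^-1 &
      forall x y, N x -> N (x ^ y)].

Definition normal_closure (A : set G) : set G :=
  [set x | forall N : set G, normal_subgroup N -> A `<=` N -> N x].

(* A pair (a, b) stands for the relation a = b. *)
Definition relations_closure (rel : set (G * G)) : set G :=
  normal_closure [set p.1 * p.2^-1 | p in rel].

End NormalClosure.

Section Smooth.
Variable R : realType.
Local Notation C := R[i].

Definition partial (v : C) (h : C -> R) (z : C) : R :=
  derive1 (fun s : R => h (z + s%:C * v)) 0.

(* h is of class C^k on the open set U, as a function of two real variables. *)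
Fixpoint class_C (k : nat) (U : set C) (h : C -> R) : Prop :=
  (forall z, U z -> {for z, continuous h}) /\
  if k is k'.+1 then
    forall v : C, v = 1 \/ v = 'i%C ->
      (forall z, U z -> derivable (fun s : R => h (z + s%:C * v)) 0 1) /\
      class_C k' U (partial v h)
  else True.

(* On a set that is not open, smooth means locally the restriction of a smooth
   map defined on an open set. *)
Definition smooth_on (A : set C) (f : C -> C) : Prop :=
  forall p, A p -> exists (U : set C) (g : C -> C),
    [/\ open U /\ U p,
        forall k, class_C k U (fun z => complex.Re (g z)),
        forall k, class_C k U (fun z => complex.Im (g z)) &
        forall z, U z -> A z -> f z = g z].

Lemma smooth_within (A : set C) (f : C -> C) :
  smooth_on A f -> {within A, continuous f}.
Proof.
move=> sf; apply/subspace_continuousP => p Ap.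
have [U [g [[oU Up] gre gim fg]]] := sf _ Ap.
have cg : g z @[z --> p] --> g p.
  by apply: (@cvg_complex _ _ (nbhs p)); [exact: ((gre 0%N).1 p Up)|exact: ((gim 0%N).1 p Up)].
rewrite /from_subspace (fg p Up Ap) => W /cg.
rewrite /= !nbhs_filterE /fmap /= /within /= => hW.
have hU : nbhs p U by exact: open_nbhs_nbhs.
move: hU hW => /filterI/[apply].
by apply: filterS => z [Uz Wz] Az; rewrite fg.
Qed.

End Smooth.

Section BraidGroup.
Variable R : realType.
Local Notation C := R[i].
Local Notation I := (unit_interval R).

Definition disk : set C := [set z | `|z| <= 4].

Definition base : C := - 4 * 'i%C.

Record config := Config {
  config_set :> set C;
  config_finite : finite_set config_set;
  config_disk : config_set `<=` disk;
  config_base : ~ config_set base }.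

(* Diffeomorphisms of the disk that are the identity on its boundary. The
   values of the two maps off the disk play no role. *)
Record diffeo := Diffeo {
  diffeo_fun :> C -> C;
  diffeo_inv : C -> C;
  diffeo_smooth : smooth_on disk diffeo_fun;
  diffeo_inv_smooth : smooth_on disk diffeo_inv;
  diffeo_disk : forall z, disk z -> disk (diffeo_fun z);
  diffeo_inv_disk : forall z, disk z -> disk (diffeo_inv z);
  diffeo_funK : forall z, disk z -> diffeo_inv (diffeo_fun z) = z;
  diffeo_invK : forall z, disk z -> diffeo_fun (diffeo_inv z) = z;
  diffeo_boundary : forall z, `|z| = 4 -> diffeo_fun z = z }.

Lemma normr_base : `|base| = 4.
Proof.
rewrite /base normrM normrN (ger0_norm (ler0n _ _)).
have -> : `|'i%C| = 1 :> C.
  by rewrite normc_def /= expr0n expr1n add0r sqrtr1.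
by rewrite mulr1.
Qed.

Section PuncturedDisk.
Variable K : config.

Definition punctured : set C := disk `\` K.

Lemma base_punctured : base \in punctured.
Proof.
by rewrite inE; split; [rewrite /disk /= normr_base|exact: config_base].
Qed.

Definition basepoint : punctured := exist _ base base_punctured.

Local Notation pi1K := (pi1 basepoint).

Record braid_diffeo := BraidDiffeo {
  braid_diffeo_val :> diffeo;
  braid_diffeo_config : [set braid_diffeo_val z | z in K] = K }.

Lemma braid_diffeo_punctured (f : braid_diffeo) z :
  punctured z -> punctured (f z).
Proof.
move=> [Dz Kz]; split; first exact: diffeo_disk.
rewrite -(braid_diffeo_config f) => -[w Kw] /(congr1 (diffeo_inv f)).
rewrite !diffeo_funK //; last exact: config_disk Kw.
by move=> wz; apply: Kz; rewrite -wz.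
Qed.

Lemma punctured_cts (f : braid_diffeo) : {within punctured, continuous f}.
Proof.
apply: (@within_sub _ _ disk); first by move=> z [].
exact/smooth_within/diffeo_smooth.
Qed.

Lemma loop_map_cts (f : braid_diffeo) (l : loop basepoint) :
  {within I, continuous (f \o l)}.
Proof.
exact: (within_comp (@punctured_cts f) (@loop_cts _ _ _ l) (@loop_in _ _ _ l)).
Qed.

Lemma loop_map_in (f : braid_diffeo) (l : loop basepoint) t :
  I t -> punctured ((f \o l) t).
Proof. by move=> It; apply: braid_diffeo_punctured; exact: loop_in. Qed.

Lemma loop_map0 (f : braid_diffeo) (l : loop basepoint) : (f \o l) 0 = base.
Proof. by rewrite /= loop0 diffeo_boundary ?normr_base. Qed.

Lemma loop_map1 (f : braid_diffeo) (l : loop basepoint) : (f \o l) 1 = base.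
Proof. by rewrite /= loop1 diffeo_boundary ?normr_base. Qed.

Definition loop_map (f : braid_diffeo) (l : loop basepoint) : loop basepoint :=
  @Loop _ _ basepoint _ (@loop_map_cts f l) (@loop_map_in f l)
    (loop_map0 f l) (loop_map1 f l).

Definition pi1_map (f : braid_diffeo) (x : pi1K) : pi1K :=
  \pi_pi1K (loop_map f (repr x)).

Lemma pi1_mapE (f : braid_diffeo) (l : loop basepoint) :
  pi1_map f (\pi_pi1K l) = \pi_pi1K (loop_map f l).
Proof.
apply/eqP/loop_classP; have [H [cH HX H01 H0]] := repr_homotopic l.
exists (f \o H); split.
- exact: (within_comp (@punctured_cts f) cH HX).
- by move=> p /HX; exact: braid_diffeo_punctured.
- by move=> t It; rewrite /=; have [-> ->] := H01 _ It.
- by move=> s Is; rewrite /=; have [-> ->] := H0 _ Is.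
Qed.

Lemma pi1_mapM (f : braid_diffeo) (x y : pi1K) :
  pi1_map f (x * y)%g = (pi1_map f x * pi1_map f y)%g.
Proof.
elim/quotW: x => l; elim/quotW: y => l'.
rewrite pi1_catE !pi1_mapE pi1_catE.
apply/eqP/loop_classP.
have := path_homotopic_refl (@loop_cts _ _ _ (loop_map f (loop_cat l l')))
  (@loop_in _ _ _ (loop_map f (loop_cat l l'))).
by apply: path_homotopic_eq => // t It; rewrite /= /path_cat; case: ifP.
Qed.

Definition same_action (f g : braid_diffeo) : bool :=
  `[< forall x : pi1K, pi1_map f x = pi1_map g x >].

Lemma same_action_refl : reflexive same_action.
Proof. by move=> f; apply/asboolP. Qed.

Lemma same_action_sym : symmetric same_action.
Proof. by move=> f g; apply/asboolP/asboolP => fg x; rewrite fg. Qed.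

Lemma same_action_trans : transitive same_action.
Proof.
by move=> g f h /asboolP fg /asboolP gh; apply/asboolP => x; rewrite fg gh.
Qed.

HB.instance Definition _ := gen_eqMixin braid_diffeo.
HB.instance Definition _ := gen_choiceMixin braid_diffeo.

Canonical same_action_equiv :=
  EquivRel same_action same_action_refl same_action_sym same_action_trans.

Definition braid : Type := {eq_quot same_action}.
HB.instance Definition _ := Choice.on braid.
HB.instance Definition _ := EqQuotient.on braid.

Definition braid_act (b : braid) (x : pi1K) : pi1K := pi1_map (repr b) x.

Lemma braid_actE (f : braid_diffeo) (x : pi1K) :
  braid_act (\pi_braid f) x = pi1_map f x.
Proof.
have /asboolP : same_action (repr (\pi_braid f)) f by rewrite -eqmodE reprK.
exact.
Qed.

End PuncturedDisk.
End BraidGroup.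

Section BraidMonodromy.
Variable R : realType.
Local Notation C := R[i].
Local Notation I := (unit_interval R).
Local Notation D := (@disk R).

Definition motion (K : config R) (n : nat) (m : 'I_n -> R -> C) : Prop :=
  [/\ forall i, {within I, continuous (m i)},
      forall i t, I t -> D (m i t),
      forall i j t, I t -> i != j -> m i t != m j t,
      range (fun i => m i 0) = K &
      range (fun i => m i 1) = K].

Definition realizes (n : nat) (F : R -> diffeo R) (m : 'I_n -> R -> C) : Prop :=
  [/\ {within I `*` D, continuous (fun p : R * C => F p.1 p.2)},
      forall z, D z -> F 0 z = z &
      forall i t, I t -> F t (m i 0) = m i t].

Definition induced_braid (K : config R) (n : nat) (m : 'I_n -> R -> C)
    (b : braid K) : Prop :=
  motion K m /\
  exists (F : R -> diffeo R) (f : braid_diffeo K),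
    [/\ realizes F m, braid_diffeo_val f = F 1 & b = \pi_(braid K) f].

Definition fiber (S : set (C * C)) (x : C) : set C := [set y | S (x, y)].

(* The local braid monodromy at (0, 0) of a curve S contained in the product of
   the disks of radius 1 and 4; m is forced to be a motion of the fiber over 1,
   which therefore is the configuration K. *)
Definition local_braid_monodromy (S : set (C * C)) (K : config R)
    (b : braid K) : Prop :=
  exists n (m : 'I_n -> R -> C),
    [/\ forall x : C, `|x| <= 1 -> x != 0 -> (fiber S x #= `I_n)%card,
        forall t, I t -> range (fun i => m i t) = fiber S (expi (2 * pi * t)) &
        induced_braid m b].

(* The points p i turn about c by the angle theta, counterclockwise. *)
Definition rotation_motion (c : C) (theta : R) (n : nat) (p : 'I_n -> C)
  (i : 'I_n) (t : R) : C := c + expi (theta * t) * (p i - c).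

Definition segment (a b : C) (t : R) : C := a + t%:C * (b - a).

Definition circle (c a : C) (t : R) : C := c + expi (2 * pi * t) * (a - c).

Definition lasso (p : C) (e : R) : R -> C :=
  let a := p + e%:C * ((base R - p) / `|base R - p|) in
  path_cat (segment (base R) a) (path_cat (circle p a) (segment a (base R))).

Definition small_radius (K : set C) (p : C) (e : R) : Prop :=
  [/\ 0 < e, `|p| + e%:C <= 4 & forall q, K q -> q != p -> e%:C < `|q - p|].

Definition standard_gbase (K : config R) (n : nat)
    (x : 'I_n -> pi1 (basepoint K)) : Prop :=
  exists p : 'I_n -> R,
    [/\ forall i j : 'I_n, (i < j)%N -> p i < p j,
        range (fun i => (p i)%:C) = K &
        forall i, exists (e : R) (l : loop (basepoint K)),
          [/\ small_radius K (p i)%:C e,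
              forall t, I t -> l t = lasso (p i)%:C e t &
              x i = \pi_(pi1 (basepoint K)) l]].

Definition induced_relations (K : config R) (b : braid K) (n : nat)
    (x : 'I_n -> pi1 (basepoint K)) :
    set (pi1 (basepoint K) * pi1 (basepoint K)) :=
  range (fun j => (braid_act b (x j), x j)).

Definition curve : set (C * C) :=
  [set p | [/\ `|p.1| <= 1, `|p.2| <= 4 &
    p.2 * (p.2 + p.1 ^+ 2) * (p.2 - p.1 ^+ 2) = 0]].

Lemma curve_fiber1 : fiber curve 1 = [set -1; 0; 1].
Proof.
apply/seteqP; split => y /=.
  move=> [_ _ /eqP]; rewrite expr1n !mulf_eq0 subr_eq0 addr_eq0 /=.
  by move=> /orP[/orP[]|] /eqP ->; [left; right|left; left|right].
have h1 : (1 : C) <= 4 by rewrite (ler_nat _ 1 4).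
by rewrite /fiber /curve /= normr1 expr1n; move=> [[]|] ->;
  rewrite ?normrN ?normr1 ?normr0; split=> //; ring.
Qed.

Lemma curve_finite : finite_set (fiber curve 1).
Proof. by rewrite curve_fiber1; exact: finite_set3. Qed.

Lemma curve_disk : fiber curve 1 `<=` D.
Proof. by move=> y []. Qed.

Lemma curve_base : ~ fiber curve 1 (base R).
Proof.
rewrite curve_fiber1 /= => -[[]|] /(congr1 (fun z : C => `|z|)) /eqP;
  by rewrite normr_base ?normrN ?normr1 ?normr0 ?(eqr_nat _ 4 1) ?pnatr_eq0.
Qed.

Definition curve_config : config R :=
  Config curve_finite curve_disk curve_base.

End BraidMonodromy.

(* Main.v *)
Require Import Defs.
From mathcomp Require Import all_boot all_order all_algebra generic_quotient.
From mathcomp Require Import complex ring lra.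
From mathcomp Require Import all_classical all_reals all_analysis.
Set Implicit Arguments.
Unset Strict Implicit.
Unset Printing Implicit Defensive.
Import Order.TTheory GRing.Theory Num.Theory numFieldNormedType.Exports.
Local Open Scope classical_set_scope.
Local Open Scope ring_scope.
Local Open Scope complex_scope.
Local Open Scope quotient_scope.

(** The three points over exp(2 pi i t) are 0 and +/- exp(4 pi i t), so every
   motion formed by them is the rotation of K = {-1, 0, 1} by the angle 4 pi: a
   point of the motion, turned back, moves continuously in a discrete set
   ([curve_motion_rotating]).

   Let F be any isotopy of the disk that realizes this rotation, and let l be a
   loop in D - K. The maps z |-> exp(- 4 pi i s) F_s(z) fix K pointwise, hence carry
   l through a free homotopy in D - K, from l to F_1 o l, during which the base point
   runs twice clockwise along the boundary. With d the class of the boundary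
   circle, traversed once counterclockwise, this says that F_1 acts on the
   fundamental group as the conjugation x |-> d^2 x d^-2 ([rotates_action]). The
   action does not depend on F, which is the uniqueness of the braid. It exists
   because the twist of the disk that rotates the circle of radius r by the angle
   4 pi t (16 - r^2) / 15 is the required rotation on K and the identity on the
   boundary ([turn_braid]).

   It remains to express d by the lassos. Cut the disk along the slits which continue,
   behind the punctures, the segments from the base point to K. The slit disk is
   star-shaped about the base point, so that a path with end points in it defines a
   class in the fundamental group, multiplicative in the path and trivial for paths
   inside the slit disk ([tether_cat], [tether_star]); a path that crosses one slit
   from right to left inside a convex neighbourhood has a class which depends on
   the slit only ([crossing_tether]). The lasso around a puncture crosses its slit
   once in this way; the boundary crosses the slits behind 1, 0, -1 in this order.
   Therefore d = x3 x2 x1 ([boundary_lassos]).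

   The relations d^2 x_j d^-2 = x_j say that d^2 is central. The conjugates of d^2
   by x1 and by x3^-1 are (x1 x3 x2)^2 and (x2 x1 x3)^2, so the asserted relations say
   that d^2 commutes with x1 and x3, and then it commutes with x2 = x3^-1 d x1^-1,
   because it commutes with d ([conjugation_relations]). *)

(** * Continuity of complex-valued maps *)

Section ComplexContinuity.
Variable R : realType.
Local Notation C := R[i].
Variables (T : topologicalType) (A : set T).
Implicit Types f g : T -> C.

Lemma withinD f g : {within A, continuous f} -> {within A, continuous g} ->
  {within A, continuous (fun x => f x + g x)}.
Proof. by move=> cf cg x; exact: cvgD (cf x) (cg x). Qed.

Lemma withinB f g : {within A, continuous f} -> {within A, continuous g} ->
  {within A, continuous (fun x => f x - g x)}.
Proof. by move=> cf cg x; exact: cvgB (cf x) (cg x). Qed.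

Lemma withinM f g : {within A, continuous f} -> {within A, continuous g} ->
  {within A, continuous (fun x => f x * g x)}.
Proof. by move=> cf cg x; exact: (@cvgM R[i] _ _ _ f g _ _ (cf x) (cg x)). Qed.

Lemma within_cst (c : C) : {within A, continuous (fun=> c)}.
Proof. by apply: within_cts => x; exact: cvg_cst. Qed.

Lemma continuous_complex (f g : T -> R) : continuous f -> continuous g ->
  continuous (fun x => f x +i* g x).
Proof. by move=> cf cg x; apply: cvg_complex; [exact: cf|exact: cg]. Qed.

Lemma continuous_expi (f : T -> R) : continuous f ->
  continuous (fun x => expi (f x)).
Proof.
move=> cf; apply: continuous_complex => x.
  by apply: (@continuous_comp _ _ _ f (@cos R)); [exact: cf|exact: continuous_cos].
by apply: (@continuous_comp _ _ _ f (@sin R)); [exact: cf|exact: continuous_sin].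
Qed.

Lemma continuous_real_complex (f : T -> R) : continuous f ->
  continuous (fun x => (f x)%:C).
Proof. by move=> cf; apply: continuous_complex => // x; exact: cvg_cst. Qed.

End ComplexContinuity.

(** * Homotopies of paths *)

Section PathAlgebra.
Variable R : realType.
Local Notation C := R[i].
Local Notation I := (unit_interval R).
Implicit Types (X Y : set C) (f g h : R -> C) (a b c : C).

Definition path_in X f a b : Prop :=
  [/\ {within I, continuous f}, forall t, I t -> X (f t), f 0 = a & f 1 = b].

Lemma path_in_sub X Y f a b : X `<=` Y -> path_in X f a b -> path_in Y f a b.
Proof. by move=> XY [cf fX f0 f1]; split=> // t /fX /XY. Qed.

Lemma path_in_cat X f g a b c :
  path_in X f a b -> path_in X g b c -> path_in X (path_cat f g) a c.
Proof.
move=> [cf fX f0 f1] [cg gX g0 g1]; split.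
- by apply: (path_cat_cts _ cf cg); rewrite f1.
- exact: path_cat_in.
- by rewrite path_cat0.
- by rewrite path_cat1.
Qed.

Lemma itvP01 (t : R) : I t -> 0 <= t <= 1.
Proof. by rewrite /= in_itv. Qed.

Lemma clamp_half (t : R) : I t ->
  (clamp (2 * t + 0) = if t <= 2^-1 then 2 * t else 1) /\
  (clamp (2 * t + - 1) = if t <= 2^-1 then 0 else 2 * t - 1).
Proof.
move=> /itvP01/andP[t0 t1]; case: ifPn => [t2|]; last rewrite -ltNge => t2.
  split; last by rewrite clamp_le0 //; lra.
  by rewrite clamp_id ?addr0 // /= in_itv /=; lra.
split; first by rewrite clamp_ge1 //; lra.
by rewrite clamp_id // /= in_itv /=; lra.
Qed.

Lemma segment_cts a b : continuous (segment a b).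
Proof.
have c1 : continuous (fun t : R => t%:C).
  by apply: continuous_real_complex => t; exact: cvg_id.
move=> t; apply: cvgD; first exact: cvg_cst.
by apply: cvgM; [exact: c1|exact: cvg_cst].
Qed.

Lemma segment0 a b : segment a b 0 = a.
Proof. by rewrite /segment mul0r addr0. Qed.

Lemma segment1 a b : segment a b 1 = b.
Proof. by rewrite /segment mul1r addrC subrK. Qed.

Definition segment_closed X : Prop :=
  forall a b t, X a -> X b -> I t -> X (segment a b t).

Definition star_shaped a X : Prop :=
  forall b t, X b -> I t -> X (segment a b t).

Lemma segment_path X a b : (forall t, I t -> X (segment a b t)) ->
  path_in X (segment a b) a b.
Proof.
by move=> sX; split; rewrite ?segment0 ?segment1 //; exact/within_cts/segment_cts.
Qed.

Lemma segment_rev a b t : segment a b (1 - t) = segment b a t.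
Proof. by rewrite /segment rmorphB rmorph1; ring. Qed.

Lemma segment_path_rev X a b : (forall t, I t -> X (segment a b t)) ->
  path_in X (segment b a) b a.
Proof.
by move=> sX; apply: segment_path => t It; rewrite -segment_rev; exact/sX/rev_itv.
Qed.

Lemma path_homotopic_straight X f g a b : path_in X f a b -> path_in X g a b ->
  (forall s t, I s -> I t -> X (segment (f t) (g t) s)) ->
  path_homotopic X f g.
Proof.
move=> [cf fX f0 f1] [cg gX g0 g1] fgX.
exists (fun p => segment (f p.2) (g p.2) p.1); split.
- have c2 (k : R -> C) : {within I, continuous k} ->
      {within I `*` I, continuous (fun p : R * R => k p.2)}.
    move=> ck; apply: (within_comp ck (within_cts _)) => [p|p []//].
    exact: cvg_snd.
  apply: withinD; first exact: c2.
  apply: withinM; last by apply: withinB; exact: c2.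
  by apply/within_cts/continuous_real_complex => p; exact: cvg_fst.
- by move=> p [Is It]; exact: fgX.
- by move=> t It /=; rewrite segment0 segment1.
- by move=> s Is /=; rewrite f0 f1 g0 g1 /segment !subrr !mulr0 !addr0.
Qed.

Lemma path_homotopic_convex X Y f g a b : segment_closed Y -> Y `<=` X ->
  path_in Y f a b -> path_in Y g a b -> path_homotopic X f g.
Proof.
move=> cY YX pf pg.
apply: (path_homotopic_straight (path_in_sub YX pf) (path_in_sub YX pg)).
by move=> s t Is It; apply/YX/cY => //; [case: pf|case: pg] => _ + _ _; apply.
Qed.

(** A star-shaped set contracts to its centre, and the contraction never moves
   a loop's base point when that is the centre. *)
Lemma path_homotopic_star X Y f a : star_shaped a Y -> Y `<=` X -> Y a ->
  path_in Y f a a -> path_homotopic X f (fun=> a).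
Proof.
move=> sY YX Ya pf; have pc : path_in X (fun=> a) a a.
  by split=> // [|t _]; [exact: within_cst|exact: YX].
apply: path_homotopic_sym.
apply: (path_homotopic_straight pc (path_in_sub YX pf)).
by move=> s t Is It; apply/YX/sY => //; case: pf => _ + _ _; exact.
Qed.

(** The two sides are the images under H of the two halves of the boundary of
   the unit square, both going from (0, 0) to (1, 1); the square is convex, so
   these halves are homotopic in it by the linear homotopy q. When the two edges
   H (-, 0) and H (-, 1) agree, this says that the ends of a free homotopy of
   loops are conjugate by the trace of the base point. *)
Lemma path_homotopic_square X (H : R * R -> C) :
  {within I `*` I, continuous H} -> (forall p, (I `*` I) p -> X (H p)) ->
  path_homotopic X
    (path_cat (fun t => H (0, t)) (fun s => H (s, 1)))
    (path_cat (fun s => H (s, 0)) (fun t => H (1, t))).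
Proof.
move=> cH HX.
pose u (t : R) := clamp (2 * t + 0); pose v (t : R) := clamp (2 * t + - 1).
pose w (x y : R) (p : R * R) := (1 - p.1) * x + p.1 * y.
pose q (p : R * R) := (w (v p.2) (u p.2) p, w (u p.2) (v p.2) p).
have qI p : (I `*` I) p -> (I `*` I) (q p).
  move=> [/itvP01/andP[s0 s1] _]; split=> /=; rewrite in_itv /= /w;
  have /itvP01/andP[] := clampI (2 * p.2 + 0);
  have /itvP01/andP[] := clampI (2 * p.2 + - 1);
  rewrite -/(u _) -/(v _) => *; apply/andP; split; nra.
have cc (a b : R) : continuous (fun p : R * R => clamp (a * p.2 + b)).
  move=> p; apply: (@continuous_comp _ _ _ snd (fun t => clamp (a * t + b))).
    exact: cvg_snd.
  exact: continuous_clamp_affine.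
have cw (x y : R * R -> R) : continuous x -> continuous y ->
    continuous (fun p => w (x p) (y p) p).
  move=> cx cy p; apply: cvgD; apply: cvgM; try by [exact: cx|exact: cy].
    by apply: cvgB; [exact: cvg_cst|exact: cvg_fst].
  exact: cvg_fst.
have cq : {within I `*` I, continuous q}.
  by apply: within_pair; apply: within_cts; apply: cw; exact: cc.
exists (H \o q); split.
- exact: (within_comp cH cq qI).
- by move=> p /qI/HX.
- move=> t It; rewrite /= /q /w /u /v /=; have [-> ->] := clamp_half It.
  by rewrite /path_cat; case: ifP => _; split; congr (H (_, _)); ring.
- move=> s _; rewrite /= /q /w /u /v /= !path_cat0.
  rewrite path_cat1 !mulr0 !add0r !mulr1.
  have [-> ->] : clamp (0 : R) = 0 /\ clamp (- 1 : R) = 0.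
    by split; rewrite clamp_le0 //; lra.
  have [-> ->] : clamp (2 + 0 : R) = 1 /\ clamp (2 - 1 : R) = 1.
    by split; rewrite clamp_ge1 //; lra.
  by split; congr (H (_, _)); ring.
Qed.

Section Groupoid.
Variable X : set C.
Local Notation "f ~ g" := (path_homotopic X f g) (at level 70).

Lemma path_homotopic_assoc f g h a b c d :
  path_in X f a b -> path_in X g b c -> path_in X h c d ->
  path_cat f (path_cat g h) ~ path_cat (path_cat f g) h.
Proof.
move=> pf pg ph.
(* The two sides differ by a piecewise linear change of the time. *)
pose phi (t : R) := Num.max (2^-1 * t + 0)
  (Num.max (1 * t + - 4^-1) (2 * t + - 1)).
have [ck kX _ _] := path_in_cat (path_in_cat pf pg) ph.
apply: (@path_homotopic_eq _ _ _ _ _ _ _ _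
  (@path_homotopic_reparam _ _ _ phi id ck kX _ _ _ _ _ _)) => //.
- move=> t /itvP01/andP[t0 t1]; apply/esym.
  rewrite /phi /= /path_cat; case: ifPn => [t2|].
    rewrite max_l; last by rewrite ge_max; apply/andP; split; lra.
    rewrite ifT; last by lra.
    rewrite ifT; last by lra.
    by congr (f _); field.
  rewrite -ltNge => t2; case: ifPn => [t3|].
    rewrite max_r; last by rewrite le_max; apply/orP; left; lra.
    rewrite max_l; last by lra.
    rewrite ifT; last by lra.
    rewrite ifF; last by apply/negbTE; rewrite -ltNge; lra.
    by congr (g _); field.
  rewrite -ltNge => t3.
  rewrite max_r; last by rewrite le_max; apply/orP; right; lra.
  rewrite max_r; last by lra.
  rewrite ifF; last by apply/negbTE; rewrite -ltNge; lra.
  by congr (h _); ring.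
- exact: (max_fun_continuous (@continuous_affine _ 2^-1 0)
    (continuous_affine_max (a := 1) (b := - 4^-1) (c := 2) (d := - 1))).
- exact: continuous_idR.
- move=> t /itvP01/andP[t0 t1]; rewrite /phi /= in_itv /=.
  rewrite le_max !ge_max; apply/andP; split; first by apply/orP; left; lra.
  by apply/andP; split; [lra|apply/andP; split; lra].
- by rewrite /phi max_l // ?ge_max; [lra|apply/andP; split; lra].
- by rewrite /phi max_r ?le_max; [rewrite max_r; lra|apply/orP; right; lra].
Qed.

Lemma path_homotopic_cst_cat f a b : path_in X f a b ->
  path_cat (fun=> a) f ~ f.
Proof.
move=> [cf fX f0 _]; have := @path_homotopic_reparam _ _ f
  (fun t => clamp (2 * t + - 1)) id cf fX
  (@continuous_clamp_affine _ _ _) (@continuous_idR _).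
move=> /(_ (fun t _ => @clampI _ _) (fun t It => It)).
rewrite clamp_le0 ?clamp_ge1 //; try lra; move=> /(_ erefl erefl).
apply: path_homotopic_eq => // t It.
by rewrite /= (proj2 (clamp_half It)) /path_cat; case: ifP => // _.
Qed.

Lemma path_homotopic_cat_rev f a b : path_in X f a b ->
  path_cat (path_rev f) f ~ (fun=> b).
Proof.
move=> [cf fX _ f1].
have c1 : continuous (fun _ : R => 1 : R) by move=> t; exact: cvg_cst.
have c2 := @continuous_affine_max R (- 2) 1 2 (- 1).
apply: (@path_homotopic_eq _ _ _ _ _ _ _ _
  (@path_homotopic_reparam _ _ f _ _ cf fX c2 c1 _ _ _ _)).
- move=> t /itvP01/andP[t0 t1]; apply/esym.
  rewrite /= /path_cat /path_rev; case: ifPn => [t2|].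
    by rewrite max_l; [congr (f _); ring|lra].
  by rewrite -ltNge => t2; rewrite max_r //; lra.
- by move=> t _ /=.
- move=> t /itvP01/andP[t0 t1]; rewrite /= in_itv /= le_max ge_max.
  apply/andP; split; last by apply/andP; split; lra.
  by apply/orP; case: (leP t 2^-1) => t2; [left|right]; lra.
- by move=> t _; exact: I1.
- by rewrite max_l; lra.
- by rewrite max_r; lra.
Qed.

Lemma path_homotopic_refl_in f a b : path_in X f a b -> f ~ f.
Proof. by move=> [cf fX _ _]; exact: path_homotopic_refl. Qed.

Lemma path_homotopic_catr f g h a b c : path_in X f a b -> path_in X g b c ->
  g ~ h -> path_cat f g ~ path_cat f h.
Proof.
move=> pf [_ _ g0 _] gh; apply: path_homotopic_cat => //.
  by case: pf => _ _ _ ->.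
exact: path_homotopic_refl_in pf.
Qed.

Lemma path_homotopic_catl f g h a b c : path_in X f a b -> path_in X h b c ->
  f ~ g -> path_cat f h ~ path_cat g h.
Proof.
move=> [_ _ _ f1] ph fg; apply: path_homotopic_cat => //.
  by case: ph => _ _ ->.
exact: path_homotopic_refl_in ph.
Qed.

(** The detour along r, back to the common starting point a and out again, is
   traversed in both directions and cancels. *)
Lemma path_homotopic_cut f g p q (a b c d e : C) :
  path_in X p a c -> path_in X f c d -> path_in X g d e -> path_in X q e b ->
  forall r, path_in X r a d ->
  path_cat (path_cat p (path_cat f (path_rev r)))
           (path_cat r (path_cat g q)) ~
  path_cat p (path_cat (path_cat f g) q).
Proof.
move=> pp pf pg pq r pr.
have pr' : path_in X (path_rev r) d a.
  move: pr => [cr rX r0 r1]; split; first exact: path_rev_cts.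
  - by move=> t It; apply: rX; exact: rev_itv.
  - by rewrite /path_rev subr0.
  - by rewrite /path_rev subrr.
have pgq := path_in_cat pg pq.
have pend := path_in_cat pr pgq.
apply: (path_homotopic_trans (path_homotopic_sym
  (path_homotopic_assoc pp (path_in_cat pf pr') pend))).
apply: (path_homotopic_catr pp (path_in_cat (path_in_cat pf pr') pend)).
apply: path_homotopic_trans (path_homotopic_assoc pf pg pq).
apply: (path_homotopic_trans (path_homotopic_sym
  (path_homotopic_assoc pf pr' pend))).
apply: (path_homotopic_catr pf (path_in_cat pr' pend)).
apply: (path_homotopic_trans (path_homotopic_assoc pr' pr pgq)).
apply: path_homotopic_trans (path_homotopic_cst_cat pgq).
exact: (path_homotopic_catl (path_in_cat pr' pr) pgq
  (path_homotopic_cat_rev pr)).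
Qed.

End Groupoid.

Definition subpath f (s t r : R) : C := f (s + r * (t - s)).

Lemma subpath_path X Y f a b s t : path_in X f a b -> 0 <= s -> s <= t ->
  t <= 1 -> (forall r, s <= r -> r <= t -> Y (f r)) ->
  path_in Y (subpath f s t) (f s) (f t).
Proof.
move=> [cf _ _ _] s0 st t1 fY.
have rI r : I r -> s <= s + r * (t - s) <= t.
  by move=> /itvP01/andP[r0 r1]; apply/andP; split; nra.
split.
- apply: (within_comp cf).
    apply: within_cts => r; apply: cvgD; first exact: cvg_cst.
    by apply: cvgM; [exact: cvg_id|exact: cvg_cst].
  by move=> r /rI/andP[? ?]; rewrite /= in_itv /=; lra.
- by move=> r /rI/andP[? ?]; exact: fY.
- by rewrite /subpath mul0r addr0.
- by rewrite /subpath mul1r addrC subrK.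
Qed.

Lemma subpath_cat X f a b s t r : path_in X f a b -> 0 <= s -> s <= t ->
  t <= r -> r <= 1 ->
  path_homotopic X (subpath f s r) (path_cat (subpath f s t) (subpath f t r)).
Proof.
move=> [cf fX _ _] s0 st tr r1.
pose phi (x : R) := s + x * (r - s).
pose psi (x : R) := s + clamp (2 * x + 0) * (t - s) + clamp (2 * x + - 1) * (r - t).
have c1 (y : R) : continuous (fun x : R => x * y).
  by move=> x; apply: cvgM; [exact: cvg_id|exact: cvg_cst].
have c2 (m n y : R) : continuous (fun x : R => clamp (m * x + n) * y).
  move=> x; apply: cvgM; last exact: cvg_cst.
  exact: continuous_clamp_affine.
have cphi : continuous phi by move=> x; apply: cvgD; [exact: cvg_cst|exact: c1].
have cpsi : continuous psi.
  by move=> x; apply: cvgD; [apply: cvgD; [exact: cvg_cst|exact: c2]|exact: c2].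
have phiI x : I x -> I (phi x).
  by move=> /itvP01/andP[? ?]; rewrite /phi /= in_itv /=; apply/andP; split; nra.
have psiI x : I x -> I (psi x).
  move=> _; have /itvP01/andP[? ?] := clampI (2 * x + 0).
  have /itvP01/andP[? ?] := clampI (2 * x + - 1).
  by rewrite /psi /= in_itv /=; apply/andP; split; nra.
have := path_homotopic_reparam cf fX cphi cpsi phiI psiI.
have -> : phi 0 = psi 0.
  by rewrite /phi /psi !clamp_le0; [ring|lra|lra].
have -> : phi 1 = psi 1.
  by rewrite /phi /psi !clamp_ge1; [ring|lra|lra].
move=> /(_ erefl erefl); apply: path_homotopic_eq => // x Ix.
rewrite /= /psi; have [-> ->] := clamp_half Ix.
by rewrite /path_cat; case: ifP => _; rewrite /subpath; congr f; ring.
Qed.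

End PathAlgebra.

(** * Paths tethered to the base point *)

Section Tether.
Variable R : realType.
Local Notation C := R[i].
Local Notation I := (unit_interval R).
Variables (X : set C) (u : X).
Local Notation u0 := (set_val u).
Implicit Types (f g : R -> C) (l : loop u).

(** A total function, so that classes of explicit paths can be written down
   without carrying proofs; it is only meaningful on loops. *)
Definition loop_class f : pi1 u :=
  match pselect (path_in X f u0 u0) with
  | left (And4 cf fX f0 f1) => \pi_(pi1 u) (Loop cf fX f0 f1)
  | right _ => 1%g
  end.

Lemma loop_classE f l : path_in X f u0 u0 -> path_homotopic X l f ->
  \pi_(pi1 u) l = loop_class f.
Proof.
move=> pf lf; rewrite /loop_class; case: pselect => // -[cf fX f0 f1].
exact/eqP/loop_classP.
Qed.

Lemma loop_class_homotopic f g : path_in X f u0 u0 -> path_in X g u0 u0 ->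
  path_homotopic X f g -> loop_class f = loop_class g.
Proof.
move=> pf pg fg; rewrite {1}/loop_class; case: pselect => // -[cf fX f0 f1].
exact: loop_classE.
Qed.

Lemma loop_class_repr f : path_in X f u0 u0 ->
  exists2 l : loop u, loop_fun l = f & loop_class f = \pi_(pi1 u) l.
Proof.
rewrite /loop_class; case: pselect => // -[cf fX f0 f1] _.
by exists (Loop cf fX f0 f1).
Qed.

Lemma loop_class_cat f g : path_in X f u0 u0 -> path_in X g u0 u0 ->
  loop_class (path_cat f g) = (loop_class f * loop_class g)%g.
Proof.
move=> pf pg; have [l lf ->] := loop_class_repr pf.
have [l' lg ->] := loop_class_repr pg; rewrite pi1_catE; apply/esym.
apply: loop_classE; first exact: path_in_cat pf pg.
rewrite /= lf lg; exact: path_homotopic_refl_in (path_in_cat pf pg).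
Qed.

Variable V : set C.
Hypotheses (VX : V `<=` X) (Vu : V u0) (Vstar : star_shaped u0 V).

Lemma loop_class_star f : path_in V f u0 u0 -> loop_class f = 1%g.
Proof.
move=> pf; have pc : path_in X (fun=> u0) u0 u0.
  by split=> // [|t _]; [exact: within_cst|exact: VX].
rewrite (loop_class_homotopic (path_in_sub VX pf) pc).
  apply/esym/(@loop_classE _ (loop_cst u)) => //.
  exact: path_homotopic_refl_in pc.
exact: path_homotopic_star Vstar VX Vu pf.
Qed.

(** A path with end points in V becomes a loop when both ends are joined to the
   base point by segments, which V contains. *)
Definition tethered f : R -> C :=
  path_cat (segment u0 (f 0)) (path_cat f (segment (f 1) u0)).

Definition tether f : pi1 u := loop_class (tethered f).

Lemma tethered_path Y f a b : V `<=` Y -> path_in Y f a b -> V a -> V b ->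
  path_in Y (tethered f) u0 u0.
Proof.
move=> VY pf Va Vb; have [_ _ f0 f1] := pf; rewrite /tethered f0 f1.
apply: (path_in_cat (b := a)).
  by apply: segment_path => t It; apply/VY/Vstar.
apply: path_in_cat pf _.
by apply: segment_path_rev => t It; apply/VY/Vstar.
Qed.

Lemma tether_homotopic f g a b : path_in X f a b -> path_in X g a b ->
  V a -> V b -> path_homotopic X f g -> tether f = tether g.
Proof.
move=> pf pg Va Vb fg; have pF := tethered_path VX pf Va Vb.
apply: (loop_class_homotopic pF (tethered_path VX pg Va Vb)).
have [_ _ f0 f1] := pf; have [_ _ g0 g1] := pg.
rewrite /tethered f0 f1 g0 g1.
have pa : path_in X (segment u0 a) u0 a.
  by apply: segment_path => t It; apply/VX/Vstar.
have pb : path_in X (segment b u0) b u0.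
  by apply: segment_path_rev => t It; apply/VX/Vstar.
apply: (path_homotopic_catr pa (path_in_cat pf pb)).
exact: path_homotopic_catl pf pb fg.
Qed.

(** A path inside V is closed up inside V, and V contracts to the base point. *)
Lemma tether_star f a b : path_in V f a b -> tether f = 1%g.
Proof.
move=> pf; have [_ fV f0 f1] := pf; apply: loop_class_star.
apply: (tethered_path _ pf) => //.
  by rewrite -f0; apply: fV; exact: I0.
by rewrite -f1; apply: fV; exact: I1.
Qed.

Lemma tether_loop f : path_in X f u0 u0 -> tether f = loop_class f.
Proof.
move=> pf; have [_ _ f0 f1] := pf.
have pu : path_in V (segment u0 u0) u0 u0.
  by apply: segment_path => t It; exact: Vstar.
have pu' := path_in_sub VX pu.
rewrite /tether /tethered f0 f1 loop_class_cat //; last exact: path_in_cat pf pu'.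
by rewrite loop_class_cat // loop_class_star // mul1g mulg1.
Qed.

(** The tethers at the middle point b cancel. *)
Lemma tether_cat f g a b c : path_in X f a b -> path_in X g b c ->
  V a -> V b -> V c -> tether (path_cat f g) = (tether f * tether g)%g.
Proof.
move=> pf pg Va Vb Vc; have pfg := path_in_cat pf pg.
rewrite /tether -loop_class_cat; [|exact: tethered_path pf _ _
  |exact: tethered_path pg _ _].
apply/esym/loop_class_homotopic.
- by apply: path_in_cat; [exact: tethered_path pf _ _|exact: tethered_path pg _ _].
- exact: tethered_path pfg _ _.
rewrite /tethered; have [_ _ -> ->] := pfg.
have [_ _ -> ->] := pf; have [_ _ -> ->] := pg.
have sV x (Vx : V x) : path_in X (segment u0 x) u0 x.
  by apply: segment_path => t It; apply/VX/Vstar.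
have -> : segment b u0 = path_rev (segment u0 b).
  by apply/funext => t; rewrite /path_rev segment_rev.
have -> : segment c u0 = path_rev (segment u0 c).
  by apply/funext => t; rewrite /path_rev segment_rev.
apply: (path_homotopic_cut (sV _ Va) pf pg _ (sV _ Vb)).
have -> : path_rev (segment u0 c) = segment c u0.
  by apply/funext => t; rewrite /path_rev segment_rev.
by apply: segment_path_rev => t It; apply/VX/Vstar.
Qed.

Lemma tether_split f a b (s t r : R) : path_in X f a b ->
  0 <= s -> s <= t -> t <= r -> r <= 1 -> V (f s) -> V (f t) -> V (f r) ->
  tether (subpath f s r) = (tether (subpath f s t) * tether (subpath f t r))%g.
Proof.
move=> pf s0 st tr r1 Vs Vt Vr; have [_ fX _ _] := pf.
have pX (x y : R) : 0 <= x -> x <= y -> y <= 1 ->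
    path_in X (subpath f x y) (f x) (f y).
  move=> x0 xy y1; apply: (subpath_path pf) => // z xz zy; apply: fX.
  by rewrite /= in_itv /=; lra.
have t0 : 0 <= t by lra.
have t1 : t <= 1 by lra.
have pst := pX _ _ s0 st t1; have ptr := pX _ _ t0 tr r1.
rewrite -(tether_cat pst ptr) //.
apply: (tether_homotopic (pX _ _ s0 (le_trans st tr) r1)) => //.
  exact: path_in_cat pst ptr.
exact: subpath_cat pf s0 st tr r1.
Qed.

(** Inside the convex set W both paths are determined by their end points, so f
   is g preceded and followed by segments; these lie in V, where the tethered
   class is trivial. Thus the end points may slide inside V. *)
Lemma tether_convex W f g a b a' b' : segment_closed W -> W `<=` X ->
  path_in W f a b -> path_in W g a' b' ->
  (forall t, I t -> V (segment a a' t)) ->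
  (forall t, I t -> V (segment b' b t)) -> tether f = tether g.
Proof.
move=> cW WX pf pg aV bV.
have ends h x y : path_in W h x y -> W x /\ W y.
  by move=> [_ hW <- <-]; split; apply: hW; [exact: I0|exact: I1].
have [[Wa Wb] [Wa' Wb']] := (ends _ _ _ pf, ends _ _ _ pg).
have pa := segment_path aV; have pb := segment_path bV.
have Vends x y : (forall t, I t -> V (segment x y t)) -> V x /\ V y.
  move=> xyV; split.
    by rewrite -[x](segment0 _ y); apply: xyV; exact: I0.
  by rewrite -[y](segment1 x); apply: xyV; exact: I1.
have [[Va Va'] [Vb' Vb]] := (Vends _ _ aV, Vends _ _ bV).
have pW x y : W x -> W y -> path_in W (segment x y) x y.
  by move=> Wx Wy; apply: segment_path => t It; exact: cW.
have pgb := path_in_cat pg (pW _ _ Wb' Wb).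
have pagb := path_in_cat (pW _ _ Wa Wa') pgb.
rewrite (tether_homotopic (path_in_sub WX pf) (path_in_sub WX pagb)) //; last first.
  exact: path_homotopic_convex cW WX pf pagb.
rewrite (tether_cat (path_in_sub VX pa) (path_in_sub WX pgb)) //.
rewrite (tether_cat (path_in_sub WX pg) (path_in_sub VX pb)) //.
by rewrite (tether_star pa) (tether_star pb) mul1g mulg1.
Qed.

End Tether.

(** * The disk slit behind the punctures *)

Section SlitDisk.
Variable R : realType.
Local Notation C := R[i].
Local Notation I := (unit_interval R).
Local Notation Re := complex.Re.
Local Notation Im := complex.Im.
Local Notation K := (curve_config R).
Implicit Types (k t : R) (z w : C).

Lemma normc_sq z (r : R) : 0 <= r ->
  (`|z| <= r%:C) = (Re z ^+ 2 + Im z ^+ 2 <= r ^+ 2).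
Proof.
move=> r0; rewrite normc_def lecR -[in LHS](ger0_norm r0) -sqrtr_sqr.
by rewrite ler_sqrt // sqr_ge0.
Qed.

Lemma diskE z : disk z <-> Re z ^+ 2 + Im z ^+ 2 <= 16.
Proof.
have -> : (16 : R) = 4 ^+ 2 by ring.
rewrite -normc_sq // /disk /=; have -> : (4 : R)%:C = 4 :> C by rewrite rmorph_nat.
by [].
Qed.

Lemma Re_base : Re (base R) = 0.
Proof. by rewrite /base mulNr -mulr_natl; simpc. Qed.

Lemma Im_base : Im (base R) = - 4.
Proof. by rewrite /base mulNr mulr_natl raddfN raddfMn /=. Qed.

Lemma baseE : base R = 0 +i* (- 4).
Proof. by apply/eqP; rewrite eq_complex Re_base Im_base !eqxx. Qed.

Definition puncture k : Prop := [\/ k = -1, k = 0 | k = 1].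

Lemma curve_configE z : config_set K z <-> exists2 k, puncture k & z = k%:C.
Proof.
have -> : config_set K = [set -1; 0; 1] by rewrite -curve_fiber1.
have N1 : (-1 : R)%:C = -1 :> C by rewrite rmorphN rmorph1.
split => [|[k + ->]] /=.
  move=> [[->|->]|->]; [exists (-1)|exists 0|exists 1] => //;
  by [exact: Or31|exact: Or32|exact: Or33].
by move=> [] ->; rewrite ?N1; tauto.
Qed.

Lemma Re_segment a b t : Re (segment a b t) = Re a + t * (Re b - Re a).
Proof. by case: a b => [x y] [x' y'] /=; rewrite mul0r subr0. Qed.

Lemma Im_segment a b t : Im (segment a b t) = Im a + t * (Im b - Im a).
Proof. by case: a b => [x y] [x' y'] /=; rewrite mul0r addr0. Qed.

(** The points with lin k z = 0 are those of the line through the base point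
   and k. *)
Definition lin k z : R := 4 * Re z - k * (Im z + 4).

Lemma lin_segment k a b t : lin k (segment a b t) = lin k a + t * (lin k b - lin k a).
Proof. by rewrite /lin Re_segment Im_segment; ring. Qed.

Lemma lin_base k : lin k (base R) = 0.
Proof. by rewrite /lin Re_base Im_base; ring. Qed.

(** The disk cut along the rays that continue, behind each puncture, the segment
   from the base point to that puncture. *)
Definition slit_disk : set C :=
  [set z | disk z /\ forall k, puncture k -> 0 <= Im z -> lin k z != 0].

(** The part above the real axis of the sector that the base point spans with
   the interval from k - 1 to k + 1: a convex set around the slit behind k,
   disjoint from K and from the other slits. *)
Definition cone k : set C := [set z | [/\ disk z, 0 < Im z & `|lin k z| < Im z + 4]].

Lemma between_gt0 (x y t : R) : 0 < x -> 0 < y -> I t -> 0 < x + t * (y - x).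
Proof.
move=> x0 y0 /itvP01/andP[t0 t1]; have [xy|yx] := leP x y.
  by rewrite ltr_pwDl // mulr_ge0 // subr_ge0.
by have : t * (x - y) <= x - y by [rewrite ler_piMl // subr_ge0 ltW|]; lra.
Qed.

Lemma disk_closed : segment_closed (@disk R).
Proof.
move=> a b t /diskE Da /diskE Db /itvP01/andP[t0 t1]; apply/diskE.
rewrite Re_segment Im_segment.
move: (Re a) (Im a) (Re b) (Im b) Da Db => x y x' y' Da Db.
have -> : (x + t * (x' - x)) ^+ 2 + (y + t * (y' - y)) ^+ 2 =
  (1 - t) * (x ^+ 2 + y ^+ 2) + t * (x' ^+ 2 + y' ^+ 2)
   - t * (1 - t) * ((x - x') ^+ 2 + (y - y') ^+ 2) by ring.
have h : 0 <= t * (1 - t) * ((x - x') ^+ 2 + (y - y') ^+ 2).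
  by rewrite mulr_ge0 ?addr_ge0 ?sqr_ge0 // mulr_ge0 //; lra.
nra.
Qed.

Lemma base_disk : disk (base R).
Proof. by apply/diskE; rewrite Re_base Im_base; lra. Qed.

Lemma base_slit_disk : slit_disk (base R).
Proof.
by split; [exact: base_disk|move=> k _; rewrite Im_base; lra].
Qed.

Lemma slit_disk_punctured : slit_disk `<=` punctured K.
Proof.
move=> z [Dz zk]; split=> // /curve_configE[k pk zE].
have := zk k pk; rewrite zE /= lexx => /(_ isT).
by rewrite /lin /= add0r mulrC subrr eqxx.
Qed.

(** Each slit is a ray of the pencil through the base point, continued to the
   boundary: a segment from the base point that ends off the slit avoids it. *)
Lemma slit_disk_star : star_shaped (base R) slit_disk.
Proof.
move=> z t [Dz zk] It; split; first by apply: disk_closed => //; exact: base_disk.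
move=> k pk; rewrite Im_segment lin_segment lin_base Im_base add0r subr0 => y0.
have /itvP01/andP[t0 t1] := It.
have z0 : 0 <= Im z by nra.
rewrite mulf_neq0 ?zk //; apply/eqP => tE.
by move: y0; rewrite tE; lra.
Qed.

Lemma cone_closed k : segment_closed (cone k).
Proof.
move=> a b t [Da a0 ak] [Db b0 bk] It; split; first exact: disk_closed.
  by rewrite Im_segment between_gt0.
move: ak bk; rewrite !ltr_norml Im_segment lin_segment.
move=> /andP[a1 a2] /andP[b1 b2]; apply/andP; split.
  have : 0 < lin k a + (Im a + 4) by lra.
  have : 0 < lin k b + (Im b + 4) by lra.
  by move=> hb ha; have := between_gt0 ha hb It; lra.
have : 0 < Im a + 4 - lin k a by lra.
have : 0 < Im b + 4 - lin k b by lra.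
by move=> hb ha; have := between_gt0 ha hb It; lra.
Qed.

Lemma cone_punctured k : cone k `<=` punctured K.
Proof.
move=> z [Dz z0 _]; split=> // /curve_configE[k' _ zE].
by move: z0; rewrite zE ltxx.
Qed.

Lemma puncture_dist k k' : puncture k -> puncture k' -> k != k' ->
  k' + 1 <= k \/ k + 1 <= k'.
Proof.
by move=> [] -> [] ->; rewrite ?eqxx // => _;
  first [by left; lra|by right; lra].
Qed.

(** For another puncture k' the values lin k' z and lin k z differ by
   (k - k') (Im z + 4), whereas lin k z is smaller than Im z + 4 in absolute value. *)
Lemma cone_slit_disk k z : puncture k -> cone k z -> lin k z != 0 -> slit_disk z.
Proof.
move=> pk [Dz z0 zk] kz; split=> // k' pk' _.
case: (eqVneq k k') => [<- //|kk']; apply/eqP => k'z.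
have kE : lin k z = (k' - k) * (Im z + 4) by move: k'z; rewrite /lin; lra.
move: zk; rewrite kE ltr_norml => /andP[? ?].
by case: (puncture_dist pk pk' kk') => ?; nra.
Qed.

(** The function lin k is affine, hence keeps its sign along a segment whose end
   points are on the same side of the slit. *)
Lemma cone_segment k a b t : puncture k -> cone k a -> cone k b ->
  0 < lin k a * lin k b -> I t -> slit_disk (segment a b t).
Proof.
move=> pk ca cb ab It; apply: (cone_slit_disk pk (cone_closed ca cb It)).
rewrite lin_segment; have /itvP01/andP[t0 t1] := It.
apply/eqP => h.
have : (1 - t) * (lin k a ^+ 2) + t * (lin k a * lin k b) = 0.
  by transitivity (lin k a * (lin k a + t * (lin k b - lin k a))); [ring|rewrite h mulr0].
have a2 : 0 < lin k a ^+ 2.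
  by rewrite exprn_even_gt0 //=; apply/eqP => a0; move: ab; rewrite a0 mul0r ltxx.
by move: (lin k a ^+ 2) (lin k a * lin k b) a2 ab => x y *; nra.
Qed.

Local Notation bp := (basepoint K).
Local Notation tether := (@tether R (punctured K) bp).

(** Between the times s and t the path f passes, inside the cone of k, from the
   right of the slit behind k to its left. *)
Definition crosses k (f : R -> C) (s t : R) : Prop :=
  [/\ 0 <= s, s <= t & t <= 1] /\
  [/\ forall r, s <= r -> r <= t -> cone k (f r), 0 < lin k (f s) & lin k (f t) < 0].

Lemma crosses_ends k f s t : puncture k -> crosses k f s t ->
  slit_disk (f s) /\ slit_disk (f t).
Proof.
move=> pk [[s0 st t1] [fc fs ft]]; split; apply: (cone_slit_disk pk).
- exact: fc.
- by rewrite gt_eqF.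
- exact: fc.
- by rewrite lt_eqF.
Qed.

(** The class of a crossing depends on the slit only: the end points of two
   crossings are joined inside the cone without meeting the slit. *)
Lemma crossing_tether k f g a b a' b' s t s' t' : puncture k ->
  path_in (punctured K) f a b -> path_in (punctured K) g a' b' ->
  crosses k f s t -> crosses k g s' t' ->
  tether (subpath f s t) = tether (subpath g s' t').
Proof.
move=> pk pf pg [[s0 st t1] [fc fs ft]] [[s0' st' t1'] [gc gs gt]].
apply: (@tether_convex _ _ bp _ slit_disk_punctured base_slit_disk slit_disk_star
  _ _ _ _ _ _ _ (@cone_closed k)
  (@cone_punctured k) (subpath_path pf s0 st t1 fc)
  (subpath_path pg s0' st' t1' gc)) => r Ir.
- by apply: cone_segment pk (fc _ _ _) (gc _ _ _) _ Ir => //; exact: mulr_gt0.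
- by apply: cone_segment pk (gc _ _ _) (fc _ _ _) _ Ir => //; rewrite nmulr_rgt0.
Qed.

Lemma slit_disk_tether f a b s t : path_in (punctured K) f a b ->
  0 <= s -> s <= t -> t <= 1 -> (forall r, s <= r -> r <= t -> slit_disk (f r)) ->
  tether (subpath f s t) = 1%g.
Proof.
move=> pf s0 st t1 fV.
by apply: (@tether_star _ _ bp _ slit_disk_punctured base_slit_disk
  slit_disk_star _ _ _
  (subpath_path pf s0 st t1 fV)).
Qed.

End SlitDisk.

(** * Slits crossed by circles *)

Section CircleCrossings.
Variable R : realType.
Local Notation C := R[i].
Local Notation I := (unit_interval R).
Local Notation Re := complex.Re.
Local Notation Im := complex.Im.
Local Notation K := (curve_config R).
Local Notation bp := (basepoint K).
Local Notation tether := (@tether R (punctured K) bp).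
Local Notation loop_class := (@loop_class R (punctured K) bp).
Implicit Types (k t e m : R) (z w : C).

(** Circles are written with the half angle pi t: the ray from the base point
   through the point of the boundary at time t meets the real axis at
   4 cs t / sn t, which makes the slits conditions on the tangent sn t / cs t. *)
Let sn t : R := sin (pi * t).
Let cs t : R := cos (pi * t).

Lemma cs2Dsn2 t : cs t ^+ 2 + sn t ^+ 2 = 1.
Proof. exact: cos2Dsin2. Qed.

Lemma half_sin_ge0 t : I t -> 0 <= sn t.
Proof.
move=> /itvP01/andP[t0 t1]; apply: sin_ge0_pi.
have p0 := pi_ge0 R; by apply/andP; split; nra.
Qed.

Lemma expi_half t : expi (2 * pi * t) = (cs t ^+ 2 - sn t ^+ 2) +i* (2 * (sn t * cs t)).
Proof.
rewrite /expi /sn /cs; have -> : 2 * pi * t = pi * t + pi * t by ring.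
by rewrite cosD sinD; congr (_ +i* _); ring.
Qed.

Definition tan_time m : R := atan m / pi.

Lemma pi_tan_time m : pi * tan_time m = atan m.
Proof. by rewrite /tan_time mulrC divfK // gt_eqF // pi_gt0. Qed.

Lemma cos_atan_gt0 m : 0 < cos (atan m).
Proof. by apply: cos_gt0_pihalf; rewrite atan_gtNpi2 atan_ltpi2. Qed.

Lemma sin_atan m : sin (atan m) = m * cos (atan m).
Proof.
have c0 : cos (atan m) != 0 by rewrite gt_eqF // cos_atan_gt0.
by rewrite -[LHS](divfK c0) -/(tan _) atanK.
Qed.

Lemma tan_time_gt0 m : 0 < m -> 0 < tan_time m.
Proof. by move=> m0; rewrite divr_gt0 ?pi_gt0 // -(atan0 R) lt_atan. Qed.

Lemma tan_time_lt m n : m < n -> tan_time m < tan_time n.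
Proof. by move=> mn; rewrite ltr_pM2r ?invr_gt0 ?pi_gt0 // lt_atan. Qed.

Lemma tan_time_lt_half m : tan_time m < 2^-1.
Proof. by rewrite ltr_pdivrMr ?pi_gt0 // mulrC; exact: atan_ltpi2. Qed.

Lemma sinBatan t m : sin (pi * t - atan m) = cos (atan m) * (sn t - m * cs t).
Proof. by rewrite sinB sin_atan /sn /cs; ring. Qed.

Lemma before_tan_time t m : I t -> 0 < m -> t <= tan_time m -> sn t <= m * cs t.
Proof.
move=> /itvP01/andP[t0 t1] m0 tm.
have p0 := pi_gt0 R; have am := pi_tan_time m; have m2 := tan_time_lt_half m.
have : 0 <= sin (- (pi * t - atan m)).
  by apply: sin_ge0_pi; rewrite -am; apply/andP; split; nra.
rewrite sinN sinBatan -mulrN pmulr_rge0 ?cos_atan_gt0 //; lra.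
Qed.

Lemma after_tan_time t m : I t -> 0 < m -> tan_time m <= t -> m * cs t <= sn t.
Proof.
move=> /itvP01/andP[t0 t1] m0 tm.
have p0 := pi_gt0 R; have am := pi_tan_time m; have m2 := tan_time_gt0 m0.
have : 0 <= sin (pi * t - atan m).
  by apply: sin_ge0_pi; rewrite -am; apply/andP; split; nra.
rewrite sinBatan pmulr_rge0 ?cos_atan_gt0 //; lra.
Qed.

Lemma sn_rev t : sn (1 - t) = sn t.
Proof.
rewrite /sn mulrBr mulr1 sinB sinpi cospi; ring.
Qed.

Lemma cs_rev t : cs (1 - t) = - cs t.
Proof.
rewrite /cs mulrBr mulr1 cosB sinpi cospi; ring.
Qed.

Lemma before_tan_time_rev t m : I t -> 0 < m -> t <= 1 - tan_time m ->
  - (m * cs t) <= sn t.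
Proof.
move=> It m0 tm; have := @after_tan_time (1 - t) m (rev_itv It) m0.
by rewrite sn_rev cs_rev mulrN; apply; lra.
Qed.

Lemma after_tan_time_rev t m : I t -> 0 < m -> 1 - tan_time m <= t ->
  sn t <= - (m * cs t).
Proof.
move=> It m0 tm; have := @before_tan_time (1 - t) m (rev_itv It) m0.
by rewrite sn_rev cs_rev mulrN; apply; lra.
Qed.

Lemma sn_tan_time m : 0 < m -> sn (tan_time m) = m * cs (tan_time m).
Proof. by move=> m0; rewrite /sn /cs !pi_tan_time sin_atan. Qed.

Lemma cs_tan_time_gt0 m : 0 < cs (tan_time m).
Proof. by rewrite /cs pi_tan_time; exact: cos_atan_gt0. Qed.

Definition boundary : R -> C := circle 0 (base R).

Lemma boundaryE t :
  boundary t = (8 * (sn t * cs t)) +i* (4 * (sn t ^+ 2 - cs t ^+ 2)).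
Proof.
rewrite /boundary /circle expi_half baseE add0r subr0; simpc.
by congr (_ +i* _); ring.
Qed.

Lemma lin_boundary k t :
  lin k (boundary t) = 8 * sn t * (4 * cs t - k * sn t).
Proof.
rewrite /lin boundaryE /=.
have -> : 4 * (sn t ^+ 2 - cs t ^+ 2) + 4 = 8 * sn t ^+ 2.
  by have := cs2Dsn2 t; lra.
by ring.
Qed.

Lemma boundary_disk t : disk (boundary t).
Proof.
apply/diskE; rewrite boundaryE /=; have h := cs2Dsn2 t.
have -> : (8 * (sn t * cs t)) ^+ 2 + (4 * (sn t ^+ 2 - cs t ^+ 2)) ^+ 2 =
  16 * (cs t ^+ 2 + sn t ^+ 2) ^+ 2 by ring.
by rewrite h expr1n mulr1.
Qed.

Lemma boundary_slit_disk t :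
  (forall k, puncture k -> 0 < sn t -> 4 * cs t - k * sn t != 0) -> I t ->
  slit_disk (boundary t).
Proof.
move=> h It; split=> [|k pk]; first exact: boundary_disk.
rewrite boundaryE /= -boundaryE lin_boundary => y0.
have s0 := half_sin_ge0 It; have sc := cs2Dsn2 t.
have s1 : 0 < sn t.
  by rewrite lt_neqAle s0 andbT; apply/eqP => s1; move: sc y0; rewrite -s1; lra.
by rewrite mulf_neq0 ?h // gt_eqF //; lra.
Qed.

Lemma boundary_cone k t : puncture k -> I t ->
  `|4 * cs t - k * sn t| < sn t -> cs t ^+ 2 < sn t ^+ 2 -> cone k (boundary t).
Proof.
move=> pk It h y0; split; first exact: boundary_disk.
  by rewrite boundaryE /=; lra.
have -> : Im (boundary t) + 4 = 8 * sn t * sn t.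
  by rewrite boundaryE /=; have := cs2Dsn2 t; lra.
have s0 : 0 < sn t by apply: le_lt_trans h; exact: normr_ge0.
by rewrite lin_boundary normrM gtr0_norm ?ltr_pM2l //; lra.
Qed.

Lemma continuous_circle (c a : C) : continuous (circle c a).
Proof.
move=> t; apply: cvgD; first exact: cvg_cst.
apply: cvgM; last exact: cvg_cst.
apply: continuous_expi => x.
by apply: cvgM; [exact: cvg_cst|exact: cvg_id].
Qed.

Lemma circle0 (c a : C) : circle c a 0 = a.
Proof. by rewrite /circle mulr0 /expi cos0 sin0 mul1r addrC subrK. Qed.

Lemma circle1 (c a : C) : circle c a 1 = a.
Proof.
rewrite /circle mulr1 /expi mulr_natl cos2pi sin2pi mul1r addrC; exact: subrK.
Qed.

Lemma boundary_path : path_in (punctured K) boundary (base R) (base R).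
Proof.
split; [|move=> t It| exact: circle0| exact: circle1].
  exact/within_cts/continuous_circle.
split; first exact: boundary_disk.
move=> /curve_configE[k pk] zE.
have : Re (boundary t) ^+ 2 + Im (boundary t) ^+ 2 = 16.
  rewrite boundaryE /=.
  have -> : (8 * (sn t * cs t)) ^+ 2 + (4 * (sn t ^+ 2 - cs t ^+ 2)) ^+ 2 =
    16 * (cs t ^+ 2 + sn t ^+ 2) ^+ 2 by ring.
  by rewrite cs2Dsn2 expr1n mulr1.
by rewrite zE /=; case: pk => ->; lra.
Qed.

(** The boundary meets the slits behind 1 and 0 when the half angle has tangent
   4 and infinity, and it is in the cone of 1 when the tangent is above 2: the
   tangents 3 and 5 separate the crossings. *)
Let t3 := tan_time 3.
Let t5 := tan_time 5.

Lemma boundary_crosses1 : crosses 1 boundary t3 t5.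
Proof.
have t30 : 0 < t3 by apply: tan_time_gt0; lra.
have t35 : t3 < t5 by apply: tan_time_lt; lra.
have t52 : t5 < 2^-1 by exact: tan_time_lt_half.
have c3 : 0 < cs t3 := cs_tan_time_gt0 _.
have c5 : 0 < cs t5 := cs_tan_time_gt0 _.
have s3 : sn t3 = 3 * cs t3 by apply: sn_tan_time; lra.
have s5 : sn t5 = 5 * cs t5 by apply: sn_tan_time; lra.
split; first by split; lra.
split=> [r r3 r5||].
- have Ir : I r by rewrite /= in_itv /=; lra.
  have sr : 3 * cs r <= sn r by apply: after_tan_time => //; lra.
  have sr5 : sn r <= 5 * cs r by apply: before_tan_time => //; lra.
  have s0 := half_sin_ge0 Ir; have h := cs2Dsn2 r.
  have c0 : 0 < cs r.
    rewrite lt_neqAle; apply/andP; split; last by lra.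
    by apply/eqP => c0; move: h; rewrite -c0 in sr5 sr *; nra.
  by apply: boundary_cone (Or33 _ _ _) Ir _ _ => //; [rewrite ltr_norml; lra|nra].
- by rewrite lin_boundary s3; nra.
- by rewrite lin_boundary s5; nra.
Qed.

Lemma boundary_crosses0 : crosses 0 boundary t5 (1 - t5).
Proof.
have t50 : 0 < t5 by apply: tan_time_gt0; lra.
have t52 : t5 < 2^-1 by exact: tan_time_lt_half.
have c5 : 0 < cs t5 := cs_tan_time_gt0 _.
have s5 : sn t5 = 5 * cs t5 by apply: sn_tan_time; lra.
split; first by split; lra.
split=> [r r3 r5||].
- have Ir : I r by rewrite /= in_itv /=; lra.
  have sr : 5 * cs r <= sn r by apply: after_tan_time => //; lra.
  have sr5 : - (5 * cs r) <= sn r by apply: before_tan_time_rev => //; lra.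
  have s0 := half_sin_ge0 Ir; have h := cs2Dsn2 r.
  have s1 : 0 < sn r.
    rewrite lt_neqAle s0 andbT; apply/eqP => s1; move: h.
    have -> : cs r = 0 by lra.
    by rewrite -s1; lra.
  by apply: boundary_cone (Or32 _ _ _) Ir _ _ => //; [rewrite ltr_norml; lra|nra].
- by rewrite lin_boundary s5; nra.
- by rewrite lin_boundary sn_rev cs_rev s5; nra.
Qed.

Lemma boundary_crossesN1 : crosses (-1) boundary (1 - t5) (1 - t3).
Proof.
have t30 : 0 < t3 by apply: tan_time_gt0; lra.
have t35 : t3 < t5 by apply: tan_time_lt; lra.
have t52 : t5 < 2^-1 by exact: tan_time_lt_half.
have c3 : 0 < cs t3 := cs_tan_time_gt0 _.
have c5 : 0 < cs t5 := cs_tan_time_gt0 _.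
have s3 : sn t3 = 3 * cs t3 by apply: sn_tan_time; lra.
have s5 : sn t5 = 5 * cs t5 by apply: sn_tan_time; lra.
split; first by split; lra.
split=> [r r3 r5||].
- have Ir : I r by rewrite /= in_itv /=; lra.
  have sr : - (3 * cs r) <= sn r by apply: before_tan_time_rev => //; lra.
  have sr5 : sn r <= - (5 * cs r) by apply: after_tan_time_rev => //; lra.
  have s0 := half_sin_ge0 Ir; have h := cs2Dsn2 r.
  have c0 : cs r < 0.
    rewrite lt_neqAle; apply/andP; split; last by lra.
    by apply/eqP => c0; move: h; rewrite c0 in sr5 sr *; nra.
  by apply: boundary_cone (Or31 _ _ _) Ir _ _ => //; [rewrite ltr_norml; lra|nra].
- by rewrite lin_boundary sn_rev cs_rev s5; nra.
- by rewrite lin_boundary sn_rev cs_rev s3; nra.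
Qed.

Lemma subpath01 (f : R -> C) : subpath f 0 1 = f.
Proof. by apply/funext => t; rewrite /subpath; congr f; ring. Qed.

(** The remaining arcs, at the beginning and at the end, lie in the slit disk. *)
Lemma boundary_class :
  loop_class boundary = (tether (subpath boundary t3 t5) *
    tether (subpath boundary t5 (1 - t5)) *
    tether (subpath boundary (1 - t5) (1 - t3)))%g.
Proof.
have t30 : 0 < t3 by apply: tan_time_gt0; lra.
have t35 : t3 < t5 by apply: tan_time_lt; lra.
have t52 : t5 < 2^-1 by exact: tan_time_lt_half.
have pb := boundary_path.
have [V3 V5] := crosses_ends (Or33 _ _ erefl) boundary_crosses1.
have [V5' V3'] := crosses_ends (Or31 _ _ erefl) boundary_crossesN1.
have b0 : boundary 0 = base R := circle0 _ _.
have b1 : boundary 1 = base R := circle1 _ _.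
have V0 : slit_disk (boundary 0) by rewrite b0; exact: base_slit_disk.
have V1 : slit_disk (boundary 1) by rewrite b1; exact: base_slit_disk.
rewrite -(@tether_loop _ _ bp _ (@slit_disk_punctured R) (@base_slit_disk R)
  (@slit_disk_star R) _ pb).
pose split (s t r : R) := @tether_split _ _ bp _ (@slit_disk_punctured R)
  (@slit_disk_star R) _ _ _ s t r pb.
have [h0 h1 h2] : [/\ 0 <= t3, t3 <= 1 & t3 <= t5] by split; lra.
have [h3 h4 h5] : [/\ 0 <= t5, t5 <= 1 & t5 <= 1 - t5] by split; lra.
have [h6 h7 h8] : [/\ 0 <= 1 - t5, 1 - t5 <= 1 & 1 - t5 <= 1 - t3] by split; lra.
have [h9 h10] : 0 <= 1 - t3 /\ 1 - t3 <= 1 by split; lra.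
rewrite -[X in tether X = _]subpath01 (split 0 t3 1) // (split t3 t5 1) //.
rewrite (split t5 (1 - t5) 1) // (split (1 - t5) (1 - t3) 1) //.
have -> : tether (subpath boundary 0 t3) = 1%g.
  apply: (slit_disk_tether pb) => // r r0 r3.
  have Ir : I r by rewrite /= in_itv /=; lra.
  apply: boundary_slit_disk => // k pk s0.
  have sr : sn r <= 3 * cs r by apply: before_tan_time => //; lra.
  by rewrite gt_eqF //; case: pk => ->; lra.
have -> : tether (subpath boundary (1 - t3) 1) = 1%g.
  apply: (slit_disk_tether pb) => // r r0 r3.
  have Ir : I r by rewrite /= in_itv /=; lra.
  apply: boundary_slit_disk => // k pk s0.
  have sr : sn r <= - (3 * cs r) by apply: after_tan_time_rev => //; lra.
  by rewrite lt_eqF //; case: pk => ->; lra.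
by rewrite mul1g mulg1 mulgA.
Qed.

Section Lasso.
Variables (k e : R).
Hypotheses (pk : puncture k) (e0 : 0 < e) (e1 : e < 1).

Let e2 : e ^+ 2 < 1.
Proof. by rewrite expr_lt1 // ltW. Qed.

Definition lasso_foot : C :=
  k%:C + e%:C * ((base R - k%:C) / `|base R - k%:C|).

Local Notation rim := (circle k%:C lasso_foot).

Lemma lasso_tethered : lasso k%:C e = tethered bp rim.
Proof. by rewrite /tethered circle0 circle1. Qed.

(** The rim starts at k + d (- k - 4 i), where d is e divided by the distance
   from k to the base point. *)
Lemma rimE : exists d : R, [/\ 0 < d, d ^+ 2 * (16 + k ^+ 2) = e ^+ 2 &
  forall t, rim t = (k + d * (8 * (sn t * cs t) - k * (cs t ^+ 2 - sn t ^+ 2)))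
    +i* (- (d * (4 * (cs t ^+ 2 - sn t ^+ 2) + 2 * k * (sn t * cs t))))].
Proof.
pose N := Num.sqrt (16 + k ^+ 2).
have k0 : 0 < 16 + k ^+ 2 by have := sqr_ge0 k; lra.
have N0 : 0 < N by rewrite sqrtr_gt0.
have NE : `|base R - k%:C| = N%:C.
  by rewrite normc_def baseE /=; congr (Num.sqrt _)%:C; ring.
exists (e / N); split; first exact: divr_gt0.
  by rewrite expr_div_n sqr_sqrtr ?divfK ?gt_eqF // ltW.
have fE : lasso_foot - k%:C = (e / N)%:C * (base R - k%:C).
  by rewrite /lasso_foot NE addrAC subrr add0r rmorphM /= fmorphV mulrCA mulrC mulrAC.
move=> t; rewrite /circle fE expi_half baseE; simpc.
by congr (_ +i* _); ring.
Qed.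

(** The slits fan out from each other, since all of them point away from the
   base point below: within distance 1 of k there is no other slit. *)
Lemma near_puncture_lin (x y k' : R) : puncture k' -> k != k' ->
  (x - k) ^+ 2 + y ^+ 2 < 1 -> 0 <= y -> 4 * x - k' * (y + 4) != 0.
Proof.
move=> pk' kk' h y0; apply/eqP => l0.
have xk : (x - k) ^+ 2 < 1 by have := sqr_ge0 y; lra.
have [xk1 xk2] : -1 < x - k /\ x - k < 1 by split; nra.
by case: pk pk' kk' l0 xk1 xk2 => -> [] ->; rewrite ?eqxx // => _ l0 *; lra.
Qed.

Lemma rim_dist t : (Re (rim t) - k) ^+ 2 + Im (rim t) ^+ 2 = e ^+ 2.
Proof.
have [d [d0 <- ->]] := rimE; rewrite /=.
transitivity (d ^+ 2 * (16 + k ^+ 2) * (cs t ^+ 2 + sn t ^+ 2) ^+ 2); first by ring.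
by rewrite cs2Dsn2; ring.
Qed.

Lemma rim_disk t : disk (rim t).
Proof.
apply/diskE; have h := rim_dist t.
move: (Re _) (Im _) h => x y h; have := sqr_ge0 y => y0.
have [xk1 xk2] : -1 < x - k /\ x - k < 1 by split; have := e2; nra.
by have := e2; case: pk h xk1 xk2 => -> *; nra.
Qed.

(** The rim is centred at k, so it is on the right of the line through the base
   point and k in the first half turn, and on the left in the second one. *)
Lemma lin_rim : exists2 c : R, 0 < c &
  forall t, lin k (rim t) = c * (sn t * cs t).
Proof.
have [d [d0 _ rE]] := rimE; exists (d * (16 + k ^+ 2) * 2).
  by have := sqr_ge0 k; nra.
by move=> t; rewrite /lin rE /=; ring.
Qed.

Lemma rim_slit_disk t : I t -> t <= t3 \/ 1 - t3 <= t -> slit_disk (rim t).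
Proof.
move=> It ht; split=> [|k' pk' y0]; first exact: rim_disk.
case: (eqVneq k k') => [<-|kk']; last first.
  by apply: near_puncture_lin => //; rewrite rim_dist.
have [c c0 ->] := lin_rim; apply: mulf_neq0; first by rewrite gt_eqF.
have h := cs2Dsn2 t; have s0 := half_sin_ge0 It.
have sc0 : sn t = 0 -> False.
  move=> st; have [d [d0 _ rE]] := rimE.
  move: y0 h; rewrite rE /= st => *; nra.
have sn0 : sn t != 0 by apply/eqP.
apply: mulf_neq0 => //; apply/eqP => c1; apply: sc0.
case: ht => ht.
  by have := @before_tan_time t 3 It ltac:(lra) ht; rewrite c1; lra.
by have := @after_tan_time_rev t 3 It ltac:(lra) ht; rewrite c1; lra.
Qed.

Lemma rim_cone t : t3 <= t -> t <= 1 - t3 -> cone k (rim t).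
Proof.
move=> ht ht'; have t30 : 0 < t3 by apply: tan_time_gt0; lra.
have It : I t by rewrite /= in_itv /=; lra.
have sr : 3 * cs t <= sn t by apply: after_tan_time => //; lra.
have sr' : - (3 * cs t) <= sn t by apply: before_tan_time_rev => //; lra.
have h := cs2Dsn2 t; have s0 := half_sin_ge0 It.
split; first exact: rim_disk.
  have [d [d0 _ rE]] := rimE; rewrite rE /= oppr_gt0 pmulr_rlt0 //.
  by case: pk => ->; nra.
have [d [d0 dE rE]] := rimE; rewrite ltr_norml.
have y0 : 0 <= Im (rim t).
  by rewrite rE /= oppr_ge0 pmulr_rle0 //; case: pk => ->; nra.
have lE : lin k (rim t) = d * (16 + k ^+ 2) * (2 * (sn t * cs t)).
  by rewrite /lin rE /=; ring.
have k0 := sqr_ge0 k; have k1 : k ^+ 2 <= 1 by case: pk => ->; lra.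
(* d * (16 + k ^+ 2) is e times the distance from k to the base point, hence
   at most the square root of 17. *)
have sq : (d * (16 + k ^+ 2)) ^+ 2 <= 17 * e ^+ 2 by rewrite -dE; nra.
have dk : d * (16 + k ^+ 2) <= 5 by have := e2; nra.
have dk0 : 0 <= d * (16 + k ^+ 2) by apply: mulr_ge0; lra.
have p1 : 0 <= sn t * (sn t - 3 * cs t) by apply: mulr_ge0 => //; lra.
have p2 : 0 <= sn t * (sn t + 3 * cs t) by apply: mulr_ge0 => //; lra.
have c2 := sqr_ge0 (cs t).
have [sc1 sc2] : - 1 <= 3 * (sn t * cs t) /\ 3 * (sn t * cs t) <= 1 by split; lra.
rewrite {}lE; move: (Im _) (d * _) (sn t * cs t) y0 dk dk0 sc1 sc2 {sq p1 p2 dE rE}.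
by move=> z x y *; apply/andP; split; nra.
Qed.

Lemma rim_crosses : crosses k rim t3 (1 - t3).
Proof.
have t30 : 0 < t3 by apply: tan_time_gt0; lra.
have t32 : t3 < 2^-1 by exact: tan_time_lt_half.
have c3 : 0 < cs t3 := cs_tan_time_gt0 _.
have s3 : sn t3 = 3 * cs t3 by apply: sn_tan_time; lra.
have [c c0 lE] := lin_rim.
split; first by split; lra.
split=> [r r0 r1||]; first exact: rim_cone.
  by rewrite lE s3; apply: mulr_gt0 => //; nra.
by rewrite lE sn_rev cs_rev s3 pmulr_rlt0 //; nra.
Qed.

Lemma rim_path : path_in (punctured K) rim lasso_foot lasso_foot.
Proof.
split; [|move=> t It| exact: circle0| exact: circle1].
  exact/within_cts/continuous_circle.
have [h|h] := leP t t3; first by apply/slit_disk_punctured/rim_slit_disk => //; left.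
have [h'|h'] := leP (1 - t3) t.
  by apply/slit_disk_punctured/rim_slit_disk => //; right.
by apply: cone_punctured (rim_cone _ _); exact: ltW.
Qed.

Lemma foot_slit_disk : slit_disk lasso_foot.
Proof.
rewrite -[lasso_foot](circle0 k%:C); apply: rim_slit_disk; first exact: I0.
by left; rewrite ltW // tan_time_gt0 //; lra.
Qed.

Lemma lasso_path : path_in (punctured K) (lasso k%:C e) (base R) (base R).
Proof.
rewrite lasso_tethered.
exact: (@tethered_path _ _ bp _ (@slit_disk_star R) _ _ _ _
  (@slit_disk_punctured R) rim_path foot_slit_disk foot_slit_disk).
Qed.

(** Only the middle part of the rim passes behind k; the stem and the rest of the
   rim lie in the slit disk. *)
Lemma lasso_class f (a b : C) (s t : R) : path_in (punctured K) f a b ->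
  crosses k f s t -> loop_class (lasso k%:C e) = tether (subpath f s t).
Proof.
move=> pf fc; rewrite (crossing_tether pk pf rim_path fc rim_crosses).
rewrite lasso_tethered -/(tether rim).
have t30 : 0 < t3 by apply: tan_time_gt0; lra.
have t32 : t3 < 2^-1 by exact: tan_time_lt_half.
have [h0 h1 h2] : [/\ 0 <= t3, t3 <= 1 & t3 <= 1 - t3] by split; lra.
have [h3 h4] : 0 <= 1 - t3 /\ 1 - t3 <= 1 by split; lra.
have [V3 V3'] := crosses_ends pk rim_crosses.
pose split (s t r : R) := @tether_split _ _ bp _ (@slit_disk_punctured R)
  (@slit_disk_star R) _ _ _ s t r rim_path.
have V0 : slit_disk (rim 0) by rewrite circle0; exact: foot_slit_disk.
have V1 : slit_disk (rim 1) by rewrite circle1; exact: foot_slit_disk.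
rewrite -[X in tether X = _]subpath01 (split 0 t3 1) // (split t3 (1 - t3) 1) //.
have -> : tether (subpath rim 0 t3) = 1%g.
  apply: (slit_disk_tether rim_path) => // r r0 r3.
  by apply: rim_slit_disk; [rewrite /= in_itv /=; lra|left].
have -> : tether (subpath rim (1 - t3) 1) = 1%g.
  apply: (slit_disk_tether rim_path) => // r r0 r3.
  by apply: rim_slit_disk; [rewrite /= in_itv /=; lra|right].
by rewrite mul1g mulg1.
Qed.

End Lasso.

(** Counterclockwise from the base point, the boundary crosses the slits behind
   1, 0 and -1 in this order, each of them in the same direction as the lasso
   around the corresponding puncture. *)
Lemma boundary_lassos (e1 e2 e3 : R) : 0 < e1 < 1 -> 0 < e2 < 1 -> 0 < e3 < 1 ->
  loop_class boundary = (loop_class (lasso 1%:C e3) *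
    loop_class (lasso 0%:C e2) * loop_class (lasso (-1)%:C e1))%g.
Proof.
move=> /andP[? ?] /andP[? ?] /andP[? ?]; rewrite boundary_class.
congr (_ * _ * _)%g; apply/esym; apply: lasso_class boundary_path _ => //;
  by [exact: Or33|exact: boundary_crosses1|exact: Or32|exact: boundary_crosses0
     |exact: Or31|exact: boundary_crossesN1].
Qed.

End CircleCrossings.

(** * Smooth functions on the plane *)

Section RealContinuity.
Variables (R : realType) (T : topologicalType).
Implicit Types f g : T -> R.

Lemma ctsD f g : continuous f -> continuous g -> continuous (fun x => f x + g x).
Proof. by move=> cf cg x; apply: cvgD; [exact: cf|exact: cg]. Qed.

Lemma ctsM f g : continuous f -> continuous g -> continuous (fun x => f x * g x).
Proof. by move=> cf cg x; apply: cvgM; [exact: cf|exact: cg]. Qed.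

Lemma cts_cst (c : R) : continuous (fun _ : T => c).
Proof. by move=> x; exact: cvg_cst. Qed.

Lemma cts_comp (f : T -> R) (phi : R -> R) : continuous phi -> continuous f ->
  continuous (fun x => phi (f x)).
Proof.
by move=> cphi cf x; apply: (@continuous_comp _ _ _ f phi); [exact: cf|exact: cphi].
Qed.

End RealContinuity.

Section SmoothFunctions.
Variable R : realType.
Local Notation C := R[i].
Implicit Types (k : nat) (h g : C -> R) (v z : C).
Local Notation ck k h := (class_C k setT h).

Lemma partialP v h z : derivable (fun s : R => h (z + s%:C * v)) 0 1 ->
  is_derive (0 : R) 1 (fun s : R => h (z + s%:C * v)) (partial v h z).
Proof. by move=> dh; rewrite /partial derive1E; exact: derivableP. Qed.

(** The recursive clause of class_C, for a partial derivative that is known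
   explicitly. *)
Lemma class_C_step k h : continuous h ->
  (forall v, v = 1 \/ v = 'i%C -> exists2 d : C -> R,
     forall z, is_derive (0 : R) 1 (fun s : R => h (z + s%:C * v)) (d z) &
     ck k d) -> ck k.+1 h.
Proof.
move=> ch dh; split; first by move=> z _; exact: ch.
move=> v hv; have [d hd cd] := dh v hv; split.
  by move=> z _; case: (hd z).
suff -> : partial v h = d by [].
by apply/funext => z; rewrite /partial derive1E; case: (hd z).
Qed.

Lemma class_C_cts k h : ck k h -> continuous h.
Proof. by case: k => [|k] [ch _] z; exact: ch. Qed.

Lemma class_C_partial k h v z : v = 1 \/ v = 'i%C -> ck k.+1 h ->
  is_derive (0 : R) 1 (fun s : R => h (z + s%:C * v)) (partial v h z).
Proof. by move=> hv [_ /(_ v hv) [dh _]]; apply: partialP; exact: dh. Qed.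

Lemma class_CS k h : ck k.+1 h -> ck k h.
Proof.
elim: k h => [|k IH] h ch; first by split=> // z _; exact: (@class_C_cts _ _ ch).
apply: class_C_step => [|v hv]; first exact: (@class_C_cts _ _ ch).
exists (partial v h) => [z|]; first exact: class_C_partial ch.
by apply: IH; case: ch => _ /(_ v hv) [].
Qed.

Lemma class_C_cst k (c : R) : ck k (fun=> c).
Proof.
elim: k c => [|k IH] c; first by split=> // z _; exact: cts_cst.
apply: class_C_step => [|v _]; first exact: cts_cst.
by exists (fun=> 0) => [z|]; [exact: is_derive_cst|exact: IH].
Qed.

Lemma class_CD k h g : ck k h -> ck k g -> ck k (fun z => h z + g z).
Proof.
elim: k h g => [|k IH] h g ch cg.
  by split=> // z _; exact: (ctsD (@class_C_cts _ _ ch) (@class_C_cts _ _ cg)).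
apply: class_C_step => [|v hv].
  exact: (ctsD (@class_C_cts _ _ ch) (@class_C_cts _ _ cg)).
exists (fun z => partial v h z + partial v g z) => [z|].
  exact: is_deriveD (class_C_partial z hv ch) (class_C_partial z hv cg).
by apply: IH; [case: ch|case: cg] => _ /(_ v hv) [].
Qed.

Lemma class_CM k h g : ck k h -> ck k g -> ck k (fun z => h z * g z).
Proof.
elim: k h g => [|k IH] h g ch cg.
  by split=> // z _; exact: (ctsM (@class_C_cts _ _ ch) (@class_C_cts _ _ cg)).
apply: class_C_step => [|v hv].
  exact: (ctsM (@class_C_cts _ _ ch) (@class_C_cts _ _ cg)).
exists (fun z => h z * partial v g z + g z * partial v h z) => [z|].
  have := is_deriveM (class_C_partial z hv ch) (class_C_partial z hv cg).
  by rewrite mul0r addr0.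
apply: class_CD; apply: IH; try exact: class_CS.
  by case: cg => _ /(_ v hv) [].
by case: ch => _ /(_ v hv) [].
Qed.

(** The two statements need each other: the derivative of one function brings in
   the other. *)
Lemma class_C_trig k h : ck k h ->
  ck k (fun z => cos (h z)) /\ ck k (fun z => sin (h z)).
Proof.
elim: k h => [|k IH] h ch; have c0 := @class_C_cts _ _ ch.
all: have cc := cts_comp (@continuous_cos R) c0.
all: have cs := cts_comp (@continuous_sin R) c0.
  by split; split=> // z _; [exact: cc|exact: cs].
have [Cc Cs] := IH h (class_CS ch).
split; apply: class_C_step => // v hv.
  exists (fun z => - 1 * sin (h z) * partial v h z) => [z|].
    rewrite mulN1r; have dh := class_C_partial z hv ch.
    have := @is_derive1_comp R (@cos R) _ 0 _ _ (is_derive_cos _) dh.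
    by rewrite mul0r addr0.
  apply: class_CM; last by case: ch => _ /(_ v hv) [].
  by apply: class_CM => //; exact: class_C_cst.
exists (fun z => cos (h z) * partial v h z) => [z|].
  have dh := class_C_partial z hv ch.
  have := @is_derive1_comp R (@sin R) _ 0 _ _ (is_derive_sin _) dh.
  by rewrite mul0r addr0.
by apply: class_CM => //; case: ch => _ /(_ v hv) [].
Qed.

Lemma cvg_Re (T : Type) (F : set_system T) (f : T -> C) z : Filter F ->
  f x @[x --> F] --> z -> complex.Re (f x) @[x --> F] --> complex.Re z.
Proof.
move=> FF /cvgrPdist_lt fz; apply/cvgrPdist_lt => e e0.
have e0' : 0 < e%:C :> C by rewrite ltcR.
have := fz _ e0'; apply: filterS => w /= zw; rewrite -raddfB -ltcR.
exact: le_lt_trans (normc_ge_Re _) zw.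
Qed.

Lemma cvg_Im (T : Type) (F : set_system T) (f : T -> C) z : Filter F ->
  f x @[x --> F] --> z -> complex.Im (f x) @[x --> F] --> complex.Im z.
Proof.
move=> FF fz; rewrite -[complex.Im z]opprK -ReiNIm.
have -> : (fun x => complex.Im (f x)) = (fun x => - complex.Re (f x * 'i%C)).
  by apply/funext => x; rewrite ReiNIm opprK.
have fi : f x * 'i%C @[x --> F] --> z * 'i%C.
  exact: (@cvgM R[i] _ _ FF f (fun=> 'i%C) _ _ fz (cvg_cst _)).
exact: cvgN (cvg_Re FF fi).
Qed.

Lemma continuous_Re : continuous (@complex.Re R : C -> R).
Proof. exact: (fun z => @cvg_Re _ (nbhs z) id z (nbhs_filter z) cvg_id). Qed.

Lemma continuous_Im : continuous (@complex.Im R : C -> R).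
Proof. exact: (fun z => @cvg_Im _ (nbhs z) id z (nbhs_filter z) cvg_id). Qed.

Lemma class_C_additive k (h : C -> R) : continuous h ->
  (forall z w, h (z + w) = h z + h w) -> (forall (s : R) z, h (s%:C * z) = s * h z) ->
  ck k h.
Proof.
move=> ch hD hZ; case: k => [|k]; first by split=> // z _; exact: ch.
apply: class_C_step => [|v _]; first exact: ch.
exists (fun=> h v) => [z|]; last exact: class_C_cst.
have -> : (fun s : R => h (z + s%:C * v)) = cst (h z) + (id * cst (h v)).
  by apply/funext => s; rewrite hD hZ.
have := is_deriveD (is_derive_cst (h z) (0 : R) 1)
  (is_deriveM (is_derive_id (0 : R) 1) (is_derive_cst (h v) (0 : R) 1)).
by rewrite scaler0 !add0r /= /GRing.scale /= mulr1.
Qed.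

Lemma class_C_Re k : ck k (@complex.Re R).
Proof.
apply: class_C_additive; first exact: continuous_Re.
  by move=> z w; rewrite raddfD.
by move=> s [x y]; rewrite /= mul0r subr0.
Qed.

Lemma class_C_Im k : ck k (@complex.Im R).
Proof.
apply: class_C_additive; first exact: continuous_Im.
  by move=> z w; rewrite raddfD.
by move=> s [x y]; rewrite /= mul0r addr0.
Qed.

End SmoothFunctions.

(** * The twist of the disk *)

Section Twist.
Variable R : realType.
Local Notation C := R[i].
Local Notation I := (unit_interval R).
Local Notation Re := complex.Re.
Local Notation Im := complex.Im.
Local Notation D := (@disk R).
Implicit Types (t : R) (z : C).

Definition twist_angle t z : R :=
  t * (4 * pi / 15) * (16 - (Re z * Re z + Im z * Im z)).

(** Each circle centred at 0 is rotated. The angle is an affine function of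
   |z| ^ 2, equal to 4 pi t on the unit circle and to 0 on the boundary; since K
   consists of 0 and two points of the unit circle, a polynomial angle
   meets both conditions, and makes the twist smooth. *)
Definition twist t z : C := expi (twist_angle t z) * z.

Lemma normc_expi t : `|expi t| = 1 :> C.
Proof. by rewrite normc_def /= cos2Dsin2 sqrtr1. Qed.

Lemma expiD (s t : R) : expi (s + t) = expi s * expi t.
Proof. by rewrite /expi sinD cosD; simpc; congr (_ +i* _); ring. Qed.

Lemma expi0 : expi 0 = 1 :> C.
Proof. by rewrite /expi cos0 sin0. Qed.

Lemma twist_disk t z : disk z -> disk (twist t z).
Proof. by rewrite /disk /= normrM normc_expi mul1r. Qed.

Lemma twist_angle_twist s t z : twist_angle s (twist t z) = twist_angle s z.
Proof.
rewrite /twist_angle; congr (_ * (16 - _)).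
have h w : Re w * Re w + Im w * Im w = Re (`|w| ^+ 2) by rewrite -add_Re2_Im2.
by rewrite !h normrM normc_expi mul1r.
Qed.

(** The twist preserves |z|, on which its angle depends. *)
Lemma twist_inv t z : twist (- t) (twist t z) = z.
Proof.
rewrite {1}/twist twist_angle_twist /twist mulrA -expiD.
by rewrite /twist_angle !mulNr addNr expi0 mul1r.
Qed.

Lemma twist_invV t z : twist t (twist (- t) z) = z.
Proof. by have := twist_inv (- t) z; rewrite opprK. Qed.

Lemma smooth_twist t : smooth_on D (twist t).
Proof.
have a k : class_C k setT (twist_angle t).
  apply: class_CM; first exact: class_C_cst.
  have -> : (fun z => 16 - (Re z * Re z + Im z * Im z)) =
      (fun z : C => 16 + (- 1) * (Re z * Re z + Im z * Im z)) :> (C -> R).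
    by apply/funext => z; rewrite mulN1r.
  apply: class_CD; first exact: class_C_cst.
  apply: class_CM; first exact: class_C_cst.
  by apply: class_CD; apply: class_CM; exact: class_C_Re || exact: class_C_Im.
move=> p Dp; exists setT, (twist t); split => // [|k|k].
- by split=> //; exact: openT.
- have -> : (fun z => Re (twist t z)) = (fun z => cos (twist_angle t z) * Re z +
      (- 1) * sin (twist_angle t z) * Im z) :> (C -> R).
    by apply/funext => -[x y]; rewrite /twist /expi /= mulN1r mulNr.
  have [? ?] := class_C_trig (a k); apply: class_CD; apply: class_CM => //.
  + exact: class_C_Re.
  + by apply: class_CM => //; exact: class_C_cst.
  + exact: class_C_Im.
- have -> : (fun z => Im (twist t z)) = (fun z => cos (twist_angle t z) * Im z +
      sin (twist_angle t z) * Re z) :> (C -> R).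
    by apply/funext => -[x y].
  have [? ?] := class_C_trig (a k); apply: class_CD; apply: class_CM => //.
  + exact: class_C_Im.
  + exact: class_C_Re.
Qed.

Lemma twist_boundary t z : `|z| = 4 -> twist t z = z.
Proof.
move=> z4; have h : Re z * Re z + Im z * Im z = 16.
  have := add_Re2_Im2 z; rewrite z4.
  have -> : 4 ^+ 2 = (16 : R)%:C :> C by rewrite rmorph_nat -natrX.
  by move=> /complexI; rewrite !expr2.
by rewrite /twist /twist_angle h subrr mulr0 expi0 mul1r.
Qed.

Definition twist_diffeo t : diffeo R :=
  @Diffeo R (twist t) (twist (- t)) (smooth_twist t) (smooth_twist (- t))
    (@twist_disk t) (@twist_disk (- t)) (fun z _ => twist_inv t z)
    (fun z _ => twist_invV t z)
    (@twist_boundary t).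

Lemma continuous_twist (T : topologicalType) (a : T -> R) (f : T -> C) :
  continuous a -> continuous f -> continuous (fun x => twist (a x) (f x)).
Proof.
move=> ca cf.
have c1 : continuous (fun x => Re (f x)) by move=> x; apply: cvg_Re; exact: cf.
have c2 : continuous (fun x => Im (f x)) by move=> x; apply: cvg_Im; exact: cf.
have cN (g : T -> R) (b : R) : continuous g -> continuous (fun x => b - g x).
  by move=> cg x; apply: cvgB; [exact: cvg_cst|exact: cg].
have ce : continuous (fun x => expi (twist_angle (a x) (f x))).
  apply: continuous_expi; apply: ctsM; last exact: cN (ctsD (ctsM c1 c1) (ctsM c2 c2)).
  by apply: ctsM => //; exact: cts_cst.
by move=> x; exact: (@cvgM R[i] _ _ _ _ f _ _ (ce x) (cf x)).
Qed.

End Twist.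

(** * Relations that make an element central *)

Section CentralityRelations.
Local Open Scope group_scope.
Variable G : groupType.
Implicit Types (A B : set G) (D g h : G).

Lemma normal_closure_normal A : normal_subgroup (normal_closure A).
Proof.
split=> [N [] //|x y Ax Ay N nN AN|x Ax N nN AN|x y Ax N nN AN];
  have [_ NM NV NJ] := nN.
- by apply: NM; [exact: Ax|exact: Ay].
- by apply: NV; exact: Ax.
- by apply: NJ; exact: Ax.
Qed.

Lemma sub_normal_closure A : A `<=` normal_closure A.
Proof. by move=> x Ax N _; exact. Qed.

(** Inclusions between normal closures can be checked on generators. *)
Lemma normal_closure_min A B :
  A `<=` normal_closure B -> normal_closure A `<=` normal_closure B.
Proof. by move=> AB x; apply => //; exact: normal_closure_normal. Qed.

Variables (N : set G) (nN : normal_subgroup N) (D : G).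

(** The elements that commute with D modulo N form a subgroup. *)
Definition central_mod g : Prop := N (D * g * D^-1 * g^-1).

Lemma normalJ g h : N g -> N (h * g * h^-1).
Proof.
move=> Ng; have [_ _ _ NJ] := nN.
by have := NJ g h^-1 Ng; rewrite conjgE invgK mulgA.
Qed.

(** The commutator of D with g * h is the product of the one with g and a
   conjugate of the one with h. *)
Lemma central_modM g h : central_mod g -> central_mod h -> central_mod (g * h).
Proof.
move=> cg ch; have [_ NM _ _] := nN.
have := NM _ _ cg (normalJ g ch); rewrite /central_mod.
by rewrite !invgM !mulgA !mulgVK.
Qed.

Lemma central_modV g : central_mod g -> central_mod g^-1.
Proof.
move=> cg; have [_ _ NV _] := nN.
have := normalJ g^-1 (NV _ cg); rewrite /central_mod.
by rewrite !invgM !invgK !mulgA mulVg mul1g.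
Qed.

Lemma central_mod_root g : D = g ^+ 2 -> central_mod g.
Proof.
move=> DE; have [N1 _ _ _] := nN; rewrite /central_mod.
have -> : D * g = g * D by rewrite DE expg2 mulgA.
by rewrite mulgK mulgV.
Qed.

End CentralityRelations.

Section ConjugationRelations.
Local Open Scope group_scope.
Variables (G : groupType) (x : 'I_3 -> G) (b : G -> G).
Let x1 := x (inord 0).
Let x2 := x (inord 1).
Let x3 := x (inord 2).
Let d := x3 * x2 * x1.
Hypothesis bE : forall g, b g = d ^+ 2 * g * (d ^+ 2)^-1.

(** Both families say that d ^+ 2 is central: the second one gives it directly
   for x1 and x3, hence for x2 = x3^-1 * d * x1^-1. *)
Lemma conjugation_relations :
  relations_closure (range (fun j => (b (x j), x j))) =
  relations_closure
    [set ((x3 * x2 * x1) ^+ 2, (x1 * x3 * x2) ^+ 2);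
         ((x1 * x3 * x2) ^+ 2, (x2 * x1 * x3) ^+ 2)].
Proof.
have sq1 : (x1 * x3 * x2) ^+ 2 = x1 * d ^+ 2 * x1^-1.
  by rewrite /d !expg2 !mulgA mulgK.
have sq3 : (x2 * x1 * x3) ^+ 2 = x3^-1 * d ^+ 2 * x3.
  by rewrite /d !expg2 !mulgA mulVg mul1g.
have r1 : (x3 * x2 * x1) ^+ 2 * ((x1 * x3 * x2) ^+ 2)^-1 =
    d ^+ 2 * x1 * (d ^+ 2)^-1 * x1^-1.
  by rewrite sq1 -/d !invgM invgK !mulgA.
have r2 : (x1 * x3 * x2) ^+ 2 * ((x2 * x1 * x3) ^+ 2)^-1 =
    (d ^+ 2 * x1 * (d ^+ 2)^-1 * x1^-1)^-1 *
    (d ^+ 2 * x3^-1 * (d ^+ 2)^-1 * (x3^-1)^-1).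
  by rewrite sq1 sq3 !invgM !invgK !mulgA !mulgVK.
rewrite /relations_closure; apply/seteqP; split; apply: normal_closure_min.
- set B := (X in _ `<=` normal_closure X); have nB := normal_closure_normal B.
  have [_ BM BV _] := nB.
  have c1 : central_mod (normal_closure B) (d ^+ 2) x1.
    rewrite /central_mod -r1; apply: sub_normal_closure.
    by exists ((x3 * x2 * x1) ^+ 2, (x1 * x3 * x2) ^+ 2) => //; left.
  have c3V : central_mod (normal_closure B) (d ^+ 2) x3^-1.
    have : normal_closure B ((x1 * x3 * x2) ^+ 2 * ((x2 * x1 * x3) ^+ 2)^-1).
      apply: sub_normal_closure.
      by exists ((x1 * x3 * x2) ^+ 2, (x2 * x1 * x3) ^+ 2) => //; right.
    by rewrite r2 => /(BM _ _ c1); rewrite mulVKg.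
  have c3 : central_mod (normal_closure B) (d ^+ 2) x3.
    by rewrite -[x3]invgK; exact: (central_modV nB).
  have c2 : central_mod (normal_closure B) (d ^+ 2) x2.
    have -> : x2 = x3^-1 * d * x1^-1 by rewrite /d !mulgA mulVg mul1g mulgK.
    apply: (central_modM nB) => //; last exact: (central_modV nB).
    by apply: (central_modM nB) => //; exact: (central_mod_root nB).
  move=> _ [_ [j _ <-] <-] /=; rewrite bE.
  have [-> //|[-> //|-> //]] : j = inord 0 \/ j = inord 1 \/ j = inord 2.
  case: j => -[|[|[|j]]] hj //; [left|right; left|right; right];
    by apply: val_inj; rewrite /= inordK.
- set A := (X in _ `<=` normal_closure X); have nA := normal_closure_normal A.
  have [_ AM AV _] := nA.
  have c j : central_mod (normal_closure A) (d ^+ 2) (x j).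
    apply: sub_normal_closure; exists (b (x j), x j); last by rewrite /= bE.
    by exists j.
  move=> _ [_ [->|->] <-] /=; first by rewrite r1; exact: c.
  by rewrite r2; apply: AM; [apply: AV; exact: c|apply: (central_modV nA); exact: c].
Qed.

End ConjugationRelations.

(** * The braid of the rotation *)

Section RotationBraid.
Variable R : realType.
Local Notation C := R[i].
Local Notation I := (unit_interval R).
Local Notation Re := complex.Re.
Local Notation Im := complex.Im.
Local Notation D := (@disk R).
Local Notation K := (curve_config R).
Local Notation bp := (basepoint K).
Implicit Types (t : R) (z : C).

Lemma expiD2pi (x : R) : expi (x + 2 * pi) = expi x.
Proof. by rewrite /expi mulr_natl cosD2pi sinD2pi. Qed.

Lemma boundary_twice_rev t : I t ->
  path_rev (path_cat (@boundary R) (@boundary R)) t =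
  expi (- (4 * pi * t)) * base R.
Proof.
move=> It; rewrite /path_rev /path_cat /boundary /circle !add0r !subr0.
case: ifP => _.
  rewrite -[in RHS]expiD2pi -[in RHS]expiD2pi; congr (expi _ * _); ring.
rewrite -[in RHS]expiD2pi; congr (expi _ * _); ring.
Qed.

Lemma expiK t : expi (- t) * expi t = 1 :> C.
Proof. by rewrite -expiD addNr expi0. Qed.

Definition rotates (F : R -> diffeo R) : Prop :=
  [/\ {within I `*` D, continuous (fun p : R * C => F p.1 p.2)},
      forall z, D z -> F 0 z = z &
      forall t k, I t -> config_set K k -> F t k = expi (4 * pi * t) * k].

(** Followed by the rotation of angle - 4 pi s, the diffeomorphism F s fixes K
   pointwise and sends the base point to base * expi (- 4 pi s). Hence F s, so
   corrected, carries a loop l through a free homotopy in the punctured disk, from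
   l to the image of l by F 1, whose base point runs twice clockwise around the
   boundary. Only the values of F on K enter. *)
Lemma rotates_action (F : R -> diffeo R) (f : braid_diffeo K) : rotates F ->
  braid_diffeo_val f = F 1 -> forall x : pi1 bp,
  pi1_map f x = (loop_class bp (@boundary R) ^+ 2 * x *
    (loop_class bp (@boundary R) ^+ 2)^-1)%g.
Proof.
move=> [cF F0 FK] fF; elim/quotW => l; rewrite pi1_mapE.
have [lb lbE ->] := loop_class_repr (u := bp) (boundary_path R).
pose H (p : R * R) := expi (- (4 * pi * p.1)) * F p.1 (l p.2).
have lX t : I t -> punctured K (l t) by exact: loop_in.
have cH : {within I `*` I, continuous H}.
  apply: withinM.
    apply/within_cts/continuous_expi => p; apply: cvgN.
    by apply: cvgM; [exact: cvg_cst|exact: cvg_fst].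
  apply: (@within_comp _ _ _ _ _ (fun p : R * C => F p.1 p.2)
    (fun p : R * R => (p.1, l p.2)) cF).
    apply: within_pair; first by apply: within_cts => p; exact: cvg_fst.
    apply: (within_comp (@loop_cts _ _ _ l)) => [|p [] //].
    by apply: within_cts => p; exact: cvg_snd.
  by move=> [s t] [Is It]; split=> //; exact: (lX t It).1.
have HX p : (I `*` I) p -> punctured K (H p).
  move=> [Is It]; have [Dl Kl] := lX _ It; rewrite /H; split.
    by rewrite /disk /= normrM normc_expi mul1r; exact: diffeo_disk.
  move=> Kh; apply: Kl; have Fl := FK _ _ Is Kh.
  have Dh := config_disk Kh.
  have : F p.1 (l p.2) = F p.1 (expi (- (4 * pi * p.1)) * F p.1 (l p.2)).
    by rewrite Fl mulrA [_ * expi (- _)]mulrC expiK mul1r.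
  move=> /(congr1 (diffeo_inv (F p.1))); rewrite !diffeo_funK // => lE.
  by rewrite lE.
have sq := path_homotopic_square cH HX.
have H0 t : I t -> H (0, t) = l t.
  move=> It; rewrite /H /= mulr0 oppr0 expi0 mul1r F0 //.
  exact: (lX t It).1.
have H1 t : I t -> H (1, t) = f (l t).
  move=> It; rewrite /H /= -fF mulr1 -[expi _]expiD2pi -[expi _]expiD2pi.
  by rewrite (_ : _ + _ = 0) ?expi0 ?mul1r //; ring.
have Hb s (t : R) : I s -> l t = base R -> H (s, t) = path_rev (path_cat lb lb) s.
  move=> Is lt; rewrite /H /= lt diffeo_boundary ?normr_base // lbE.
  by rewrite boundary_twice_rev.
pose g := loop_rev (loop_cat lb lb).
have gE : \pi_(pi1 bp) g = ((\pi_(pi1 bp) lb ^+ 2)^-1)%g.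
  by rewrite expg2 pi1_catE -pi1_invE.
have halves (p q p' q' : R -> C) : (forall t, I t -> p t = p' t) ->
    (forall t, I t -> q t = q' t) -> forall t, I t -> path_cat p q t = path_cat p' q' t.
  move=> pp qq t /itvP01/andP[t0 t1]; rewrite /path_cat; case: ifPn => [t2|].
    by apply: pp; rewrite /= in_itv /=; lra.
  by rewrite -ltNge => t2; apply: qq; rewrite /= in_itv /=; lra.
have : \pi_(pi1 bp) (loop_cat l g) = \pi_(pi1 bp) (loop_cat g (loop_map f l)).
  apply/eqP/loop_classP; apply: path_homotopic_eq sq => /=; apply: halves => t It //=.
  - exact: H0.
  - by apply: Hb => //; exact: loop1.
  - by apply: Hb => //; exact: loop0.
  - exact: H1.
rewrite -!pi1_catE gE => e.
rewrite -[RHS]mulgA e; exact/esym/mulVKg.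
Qed.

Lemma puncture_pow (k : R) : puncture k -> k = 0 \/ k * k = 1.
Proof. by case=> ->; [right|left|right]; ring. Qed.

Lemma twist_puncture t (k : R) : puncture k ->
  twist t k%:C = expi (4 * pi * t) * k%:C.
Proof.
move=> pk; rewrite /twist /twist_angle /= mul0r addr0.
have [->|->] := puncture_pow pk; first by rewrite !mulr0.
by congr (expi _ * _); field.
Qed.

Lemma twist_rotates : rotates (@twist_diffeo R).
Proof.
split.
- apply: within_cts; apply: continuous_twist => p; [exact: cvg_fst|exact: cvg_snd].
- by move=> z _; rewrite /= /twist /twist_angle !mul0r expi0 mul1r.
- by move=> t _ _ /curve_configE[k pk ->]; exact: twist_puncture.
Qed.

Lemma expi4pi : expi (4 * pi * 1) = 1 :> C.
Proof.
by rewrite -(expi0 R) -[RHS]expiD2pi -[RHS]expiD2pi; congr expi; ring.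
Qed.

Lemma twist1_config : [set twist_diffeo 1 z | z in config_set K] = K.
Proof.
have fixK z : config_set K z -> twist 1 z = z.
  by move=> /curve_configE[k pk ->]; rewrite twist_puncture // expi4pi mul1r.
apply/seteqP; split=> [_ [z Kz <-]|z Kz]; first by rewrite /= fixK.
by exists z => //; exact: fixK.
Qed.

Definition twist_braid_diffeo : braid_diffeo K := BraidDiffeo twist1_config.

Definition twist_braid : braid K := \pi_(braid K) twist_braid_diffeo.

Lemma twist_braid_act (x : pi1 bp) : braid_act twist_braid x =
  (loop_class bp (@boundary R) ^+ 2 * x * (loop_class bp (@boundary R) ^+ 2)^-1)%g.
Proof. by rewrite braid_actE (rotates_action twist_rotates). Qed.

Definition rotating (n : nat) (m : 'I_n -> R -> C) : Prop :=
  forall i t, I t -> m i t = expi (4 * pi * t) * m i 0.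

(** All isotopies realizing such a motion act on the fundamental group as the
   same conjugation, and a braid is determined by this action. *)
Lemma rotating_braid n (m : 'I_n -> R -> C) (b : braid K) : rotating m ->
  induced_braid m b -> b = twist_braid.
Proof.
move=> rm [[_ _ _ m0 _] [F [f [[cF F0 Fm] fF ->]]]].
have rF : rotates F.
  split=> // t k It; have -> : config_set K = range (fun i => m i 0) by [].
  by move=> [i _ <-]; rewrite Fm // rm.
apply/eqP; rewrite eqmodE; apply/asboolP => x.
by rewrite (rotates_action rF fF) (rotates_action twist_rotates).
Qed.

Local Notation turn :=
  (rotation_motion 0 (4 * pi) (fun i : 'I_3 => (i : nat)%:R - 1 : C)).

Lemma turnE i t : turn i t = expi (4 * pi * t) * ((i : nat)%:R - 1 : R)%:C.
Proof.
by rewrite /rotation_motion add0r subr0 rmorphB rmorph1 rmorph_nat.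
Qed.

Lemma ord3_puncture (i : 'I_3) : puncture ((i : nat)%:R - 1 : R).
Proof.
case: i => -[|[|[|i]]] //= _.
- by apply: Or31; ring.
- by apply: Or32; ring.
- by apply: Or33; ring.
Qed.

Lemma puncture_ord3 (k : R) : puncture k -> exists i : 'I_3, (i : nat)%:R - 1 = k.
Proof.
by case=> ->; [exists (inord 0)|exists (inord 1)|exists (inord 2)];
  rewrite inordK //; ring.
Qed.

Lemma turn_motion : motion K turn.
Proof.
have turn1 (s : R) : expi (4 * pi * s) = 1 :> C ->
    range (fun i => turn i s) = K.
  move=> s1; apply/seteqP; split=> [_ [i _ <-]|z /curve_configE[k pk ->]].
    by apply/curve_configE; rewrite turnE s1 mul1r; eexists; [exact: ord3_puncture|].
  have [i <-] := puncture_ord3 pk.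
  by exists i => //; rewrite turnE s1 mul1r.
split.
- move=> i; apply: within_eq => [t _|]; first exact/esym/turnE.
  apply: withinM; last exact: within_cst.
  apply/within_cts/continuous_expi => t.
  by apply: cvgM; [exact: cvg_cst|exact: cvg_id].
- move=> i t It; rewrite turnE /disk /= normrM normc_expi mul1r.
  by apply: config_disk; apply/curve_configE; eexists; [exact: ord3_puncture|].
- move=> i j t It; apply: contra_neq; rewrite !turnE.
  move=> /(congr1 (fun z => expi (- (4 * pi * t)) * z)).
  rewrite !mulrA expiK !mul1r => /complexI /addIr /eqP.
  by rewrite eqr_nat => /eqP; exact: val_inj.
- by apply: turn1; rewrite mulr0 expi0.
- by apply: turn1; rewrite expi4pi.
Qed.

Lemma turn_rotating : rotating turn.
Proof. by move=> i t It; rewrite !turnE mulr0 expi0 mul1r. Qed.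

Lemma turn_braid : induced_braid turn twist_braid.
Proof.
split; first exact: turn_motion.
exists (@twist_diffeo R), twist_braid_diffeo; split=> //.
have [cT T0 TK] := twist_rotates; split=> // i t It.
rewrite [RHS]turn_rotating // TK //.
by have [_ _ _ <- _] := turn_motion; exists i.
Qed.

Lemma curve_fiberE (x : C) y : `|x| <= 1 ->
  fiber (@curve R) x y <-> exists2 k : R, puncture k & y = x ^+ 2 * k%:C.
Proof.
move=> x1; have N1 : (-1 : R)%:C = -1 :> C by rewrite rmorphN rmorph1.
have x2 : `|x ^+ 2| <= 4.
  rewrite normrX; apply: (@le_trans _ _ 1); first by rewrite exprn_ile1.
  by rewrite (ler_nat _ 1 4).
split=> [[/= _ _ /eqP]|[k pk ->]].
  rewrite !mulf_eq0 subr_eq0 addr_eq0 => /orP[/orP[]|] /eqP ->.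
  - by exists 0; [exact: Or32|rewrite mulr0].
  - by exists (-1); [exact: Or31|rewrite N1 mulrN1].
  - by exists 1; [exact: Or33|rewrite mulr1].
case: pk => ->; rewrite /fiber /curve /= ?N1 ?mulrN1 ?mulr0 ?mulr1 ?normrN ?normr0;
  by split=> //; ring.
Qed.

Lemma curve_fiber_card (x : C) : `|x| <= 1 -> x != 0 ->
  (fiber (@curve R) x #= `I_3)%card.
Proof.
move=> x1 x0; pose h (j : nat) : C := x ^+ 2 * (j%:R - 1 : R)%:C.
have -> : fiber (@curve R) x = h @` `I_3.
  apply/seteqP; split=> [y /(curve_fiberE _ x1)[k pk ->]|_ [j j3 <-]].
    by have [i <-] := puncture_ord3 pk; exists (i : nat) => //=.
  apply/curve_fiberE => //; exists (j%:R - 1) => //.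
  exact: (ord3_puncture (Ordinal j3)).
apply: inj_card_eq => i j _ _ /mulfI h1.
have /h1 /complexI /addIr /eqP : x ^+ 2 != 0 by rewrite expf_eq0 /= (negbTE x0).
by rewrite eqr_nat => /eqP.
Qed.

(** Turned back by the angle 4 pi s, each point of the motion is a continuous
   function of s with values in the discrete set K, hence constant. *)
Lemma curve_motion_rotating n (m : 'I_n -> R -> C) :
  (forall i, {within I, continuous (m i)}) ->
  (forall t, I t -> range (fun i => m i t) = fiber (@curve R) (expi (2 * pi * t))) ->
  rotating m.
Proof.
move=> cm mF i t It; pose g s := expi (- (4 * pi * s)) * m i s.
have gK s : I s -> exists2 k : R, puncture k & g s = k%:C.
  move=> Is; have : range (fun i => m i s) (m i s) by exists i.
  rewrite mF // => /curve_fiberE; rewrite normc_expi lexx => /(_ isT)[k pk mE].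
  exists k => //; rewrite /g mE mulrA expr2 -!expiD.
  by rewrite (_ : _ + _ = 0) ?expi0 ?mul1r //; ring.
have cg : {within I, continuous g}.
  apply: withinM => //; apply/within_cts/continuous_expi => s; apply: cvgN.
  by apply: cvgM; [exact: cvg_cst|exact: cvg_id].
have cRe : {within I, continuous (fun s => Re (g s))}.
  by move=> s; exact: cvg_Re (cg s).
have gE : g t = g 0.
  have [k pk gk] := gK t It; have [k' pk' gk'] := gK 0 (@I0 R).
  have /itvP01/andP[t0 t1] := It.
  have ct : {within `[0, t], continuous (fun s => Re (g s))}.
    apply: within_sub cRe => s; rewrite /= !in_itv /= => /andP[s0 st].
    by rewrite s0 (le_trans st).
  (* One third of the way between two distinct elements of {-1, 0, 1} there is
     no element of this set. *)
  have hv : Num.min (Re (g 0)) (Re (g t)) <= (2 * Re (g 0) + Re (g t)) / 3 <=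
            Num.max (Re (g 0)) (Re (g t)).
    by rewrite ge_min le_max; apply/andP; split; case: (leP (Re (g 0)) (Re (g t))) => h;
      apply/orP; first [by left; lra|by right; lra].
  have [c cI] := IVT t0 ct hv.
  have Ic : I c.
    move: cI; rewrite in_itv /= => /andP[c0 ct'].
    by rewrite /= in_itv /= c0 (le_trans ct').
  have [kc pkc gkc] := gK c Ic; rewrite gk gk' gkc /= => e.
  suff -> : k = k' by [].
  by case: pk pk' pkc e => -> [] -> [] -> e; lra.
have mt : m i t = expi (4 * pi * t) * g t.
  by rewrite /g mulrA [expi _ * expi _]mulrC expiK mul1r.
by rewrite mt gE /g mulr0 oppr0 expi0 mul1r.
Qed.

End RotationBraid.

(** * The standard g-base *)

Section StandardGbase.
Variable R : realType.
Local Notation C := R[i].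
Local Notation I := (unit_interval R).
Local Notation K := (curve_config R).
Local Notation bp := (basepoint K).

Definition puncture_at (i : 'I_3) : R := (i : nat)%:R - 1.

(** Every puncture has another one at distance 1. *)
Lemma small_radius_lt1 (k e : R) : puncture k -> small_radius K k%:C e -> e < 1.
Proof.
move=> pk [_ _ near]; have [k' pk' kk'] : exists2 k', puncture k' & `|k' - k| = 1.
  case: pk => ->.
  - by exists 0; [exact: Or32|rewrite sub0r opprK normr1].
  - by exists 1; [exact: Or33|rewrite subr0 normr1].
  - by exists 0; [exact: Or32|rewrite sub0r normrN normr1].
have := near k'%:C; rewrite -rmorphB normc_def /= expr0n addr0 sqrtr_sqr kk'.
rewrite ltcR; apply; first by apply/curve_configE; exists k'.
by apply/eqP => /complexI kE; move: kk'; rewrite kE subrr normr0; lra.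
Qed.

Lemma small_radius_half (k : R) : puncture k -> small_radius K k%:C 2^-1.
Proof.
move=> pk; have h (r : R) : `|r%:C| = `|r|%:C :> C.
  by rewrite normc_def /= expr0n addr0 sqrtr_sqr.
split; first lra.
  rewrite h -rmorphD /= -[4]/(4%:R) -(rmorph_nat (@real_complex R)) lecR.
  by case: pk => ->; rewrite ?normrN ?normr1 ?normr0; lra.
move=> _ /curve_configE[k' pk' ->]; rewrite -rmorphB h ltcR => kk'.
have : k != k' by apply: contra_neq kk' => ->.
by move=> /(puncture_dist pk pk')[] ?; rewrite ltr_normr; apply/orP;
  first [by left; lra|by right; lra].
Qed.

Lemma standard_gbase_exists :
  exists x : 'I_3 -> pi1 bp, standard_gbase x.
Proof.
have lp (i : 'I_3) : path_in (punctured K) (lasso (puncture_at i)%:C 2^-1)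
    (base R) (base R).
  by apply: lasso_path; [exact: ord3_puncture|lra|lra].
exists (fun i => loop_class bp (lasso (puncture_at i)%:C 2^-1)).
exists puncture_at; split.
- by move=> i j ij; rewrite ltrD2r ltr_nat.
- apply/seteqP; split=> [_ [i _ <-]|z /curve_configE[k pk ->]].
    by apply/curve_configE; eexists; [exact: ord3_puncture|].
  by have [i <-] := puncture_ord3 pk; exists i.
move=> i; have [l lE lc] := loop_class_repr (u := bp) (lp i).
exists 2^-1, l; split=> //; first exact/small_radius_half/ord3_puncture.
by move=> t _; rewrite lE.
Qed.

(** Increasing, with range K, the centres of the lassos can only be -1, 0, 1 in
   this order; the radii remain free. *)
Lemma standard_gbase_class (x : 'I_3 -> pi1 bp) : standard_gbase x ->
  forall i, exists2 e : R, 0 < e < 1 &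
    x i = loop_class bp (lasso (puncture_at i)%:C e).
Proof.
move=> [p [p_lt pK px]] i.
have pp j : puncture (p j).
  have : config_set K (p j)%:C by rewrite -pK; exists j.
  by move=> /curve_configE[k pk /complexI ->].
have pE : p i = puncture_at i.
  pose o j : 'I_3 := inord j.
  have p01 : p (o 0%N) < p (o 1%N) by apply: p_lt; rewrite !inordK.
  have p12 : p (o 1%N) < p (o 2%N) by apply: p_lt; rewrite !inordK.
  have [j0 j1 j2] : [/\ p (o 0%N) = -1, p (o 1%N) = 0 & p (o 2%N) = 1].
    by split; case: (pp (o 0%N)) (pp (o 1%N)) (pp (o 2%N)) p01 p12 =>
      -> [] -> [] -> //; lra.
  rewrite /puncture_at -[i in LHS]inord_val.
  by case: i => -[|[|[|i]]] //= _; rewrite ?j0 ?j1 ?j2; ring.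
have [e [l [se lE ->]]] := px i; rewrite pE in se lE.
have e1 := small_radius_lt1 (ord3_puncture R i) se; have [e0 _ _] := se.
exists e; first by rewrite e0.
have pl := lasso_path (ord3_puncture R i) e0 e1.
apply: loop_classE => //; apply: path_homotopic_eq (path_homotopic_refl_in pl) => // t It.
by rewrite lE.
Qed.

Lemma gbase_boundary (x : 'I_3 -> pi1 bp) : standard_gbase x ->
  loop_class bp (@boundary R) = (x (inord 2) * x (inord 1) * x (inord 0))%g.
Proof.
move=> gx; have [e3 he3 ->] := standard_gbase_class gx (inord 2).
have [e2 he2 ->] := standard_gbase_class gx (inord 1).
have [e1 he1 ->] := standard_gbase_class gx (inord 0).
have at_inord (j : nat) : (j < 3)%N -> puncture_at (inord j) = j%:R - 1.
  by move=> j3; rewrite /puncture_at inordK.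
rewrite !at_inord // (_ : 2 - 1 = 1 :> R); last by ring.
by rewrite subrr sub0r; exact: boundary_lassos he1 he2 he3.
Qed.

End StandardGbase.

(** * The local braid monodromy *)

Theorem theorem4p10 (R : realType) :
  fiber (curve (R := R)) 1 = [set -1; 0; 1] /\
  exists beta : braid (curve_config R),
    [/\ forall b : braid (curve_config R),
          local_braid_monodromy (curve (R := R)) b <-> b = beta,
        forall b : braid (curve_config R),
          induced_braid
            (rotation_motion 0 (4 * pi) (fun i : 'I_3 => (i : nat)%:R - 1)) b
          <-> b = beta,
        exists x : 'I_3 -> pi1 (basepoint (curve_config R)), standard_gbase x &
        forall x : 'I_3 -> pi1 (basepoint (curve_config R)),
          standard_gbase x ->
          let x1 := x (inord 0) in
          let x2 := x (inord 1) in
          let x3 := x (inord 2) in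
          relations_closure (induced_relations beta x) =
          relations_closure
            [set ((x3 * x2 * x1) ^+ 2, (x1 * x3 * x2) ^+ 2)%g;
                 ((x1 * x3 * x2) ^+ 2, (x2 * x1 * x3) ^+ 2)%g]].
Proof.
split; first exact: curve_fiber1.
exists (twist_braid R); split.
- move=> b; split=> [[n [m [_ mF mb]]]|->].
    apply: (rotating_braid _ mb); have [[cm _ _ _ _] _] := mb.
    exact: curve_motion_rotating cm mF.
  exists 3%N, (rotation_motion 0 (4 * pi) (fun i : 'I_3 => (i : nat)%:R - 1)).
  split; [exact: curve_fiber_card| |exact: turn_braid].
  move=> t It; apply/seteqP; split=> [_ [i _ <-]|y].
    apply/curve_fiberE; first by rewrite normc_expi.
    exists ((i : nat)%:R - 1); first exact: ord3_puncture.
    by rewrite turnE expr2 -expiD; congr (expi _ * _); ring.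
  move=> /curve_fiberE; rewrite normc_expi lexx => /(_ isT)[k pk ->].
  have [i <-] := puncture_ord3 pk; exists i => //.
  by rewrite turnE expr2 -expiD; congr (expi _ * _); ring.
- move=> b; split=> [|->]; last exact: turn_braid.
  exact: rotating_braid (@turn_rotating R).
- exact: standard_gbase_exists.
- move=> x gx; apply: conjugation_relations => g.
  by rewrite twist_braid_act (gbase_boundary gx).
Qed.
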